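(* Let $\omega=\{\omega_n\}_{n\ge0}$ be a quasi-integral sequence of positive reals with $\omega_0=1$ and $\lim_{n\to\infty}\omega_n/\omega_{n+1}=1$. Suppose $f\in H^2_\omega$ is such that $W_f/f$ has a singularity on the unit circle and $f(0)\ne0$. Let $p_n$ denote the $n$th optimal approximant to $1/f$. For each $\varepsilon>0$, let $\tau_\varepsilon(n)$ denote the number of zeros of $p_n$ (counted with multiplicity) that lie in the disk $\{z:|z|\le1+\varepsilon\}$. Then $$\limsup_{n\to\infty}\frac{\tau_\varepsilon(n)}{n}=1.$$
   Context: $H^2_\omega$ is the Hilbert space of functions $f(z)=\sum_{n\ge0}a_nz^n$ analytic in the open unit disk $\mathbb{D}$ with $\|f\|_\omega^2=\sum|a_n|^2\omega_n<\infty$. The $n$th optimal approximant $p_n$ to $1/f$ is the unique polynomial of degree at most $n$ minimizing $\|pf-1\|_\omega$ among polynomials $p$ of degree at most $n$. $W_f$ is the orthogonal projection in $H^2_\omega$ of the constant function $1$ onto the closure of $f\cdot\mathcal{P}$, where $\mathcal{P}$ is the space of all polynomials; $W_f/f$ is analytic in $\mathbb{D}$, and it has a singularity on the unit circle if it does not extend analytically to a disk $\{|z|<R\}$ with $R>1$. A finite positive Borel measure $\mu$ on $\overline{\mathbb{D}}$ (with infinite support) is regular if the leading coefficients $\kappa_n>0$ of its orthonormal polynomials in $L^2(\mu)$ satisfy $\lim_{n\to\infty}\kappa_n^{1/n}=1$. The sequence $\omega$ is quasi-integral if there is a regular rotation invariant measure $\mu$ on $\overline{\mathbb{D}}$ such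 that the norm $\left(\int_{\overline{\mathbb{D}}}|g|^2d\mu\right)^{1/2}$ is equivalent to $\|g\|_\omega$ on $H^2_\omega$ (boundary values are used if $\mu$ charges the unit circle). *)

(* Defs.v *)
From HB Require Import structures.
From mathcomp Require Import all_boot all_order all_algebra.
From mathcomp Require Import all_classical all_reals all_analysis.
From mathcomp.real_closed Require Export complex.
Set Implicit Arguments.
Unset Strict Implicit.
Unset Printing Implicit Defensive.
Import Order.TTheory GRing.Theory Num.Theory.
Import numFieldNormedType.Exports.
Local Open Scope classical_set_scope.
Local Open Scope ring_scope.
Local Open Scope complex_scope.

(* The regular algebra [R[i]^o] is the carrier on which the library puts the
   topology and the norm of a numFieldType.  The library norm of [R[i]] takes
   its values in [R[i]]; [normc] is the R-valued modulus. *)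
Notation Cplx R := (R[i]^o).
Notation normc := Normc.normc.

Section Complex_plane.
Variable R : realType.

Definition disk (r : R) : set (Cplx R) := [set z | normc z < r].
Definition cdisk (r : R) : set (Cplx R) := [set z | normc z <= r].

Definition holomorphic_on (U : set (Cplx R)) (h : Cplx R -> Cplx R) : Prop :=
  forall z, U z -> derivable h z 1.

Definition Cborel := g_sigma_algebraType (@open (Cplx R)).

End Complex_plane.

(* An analytic function on the open unit disk is encoded by the sequence of its
   Taylor coefficients at 0. *)
Section Weighted_Hardy_space.
Variables (R : realType) (w : nat -> R).
Implicit Types (f g : nat -> Cplx R) (q : {poly R[i]}).

Definition ps_eval f (z : Cplx R) : Cplx R :=
  limn (series (fun n => f n * z ^+ n : Cplx R)).

Definition analytic_in_unit_disk f : Prop :=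
  forall z : Cplx R, disk 1 z -> cvgn (series (fun n => f n * z ^+ n : Cplx R)).

Definition H2norm f : \bar R :=
  sqrte (\sum_(0 <= n <oo) (normc (f n) ^+ 2 * w n)%:E)%E.

Definition H2 : set (nat -> Cplx R) :=
  [set f | analytic_in_unit_disk f /\ (H2norm f < +oo)%E].

Definition H2inner f g : Cplx R :=
  limn (series (fun n => f n * (g n)^* * (w n)%:C : Cplx R)).

Definition ps_one : nat -> Cplx R := fun n => (n == 0%N)%:R.

Definition ps_sub f g : nat -> Cplx R := fun n => f n - g n.

(* Cauchy product *)
Definition poly_mul q f : nat -> Cplx R :=
  fun n => \sum_(k < n.+1) q`_k * f (n - k)%N.

Definition closure_fP f : set (nat -> Cplx R) :=
  [set g | H2 g /\ forall e : R, 0 < e ->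
     exists q, (H2norm (ps_sub (poly_mul q f) g) < e%:E)%E].

Definition is_orthogonal_projection (M : set (nat -> Cplx R)) f g : Prop :=
  M g /\ forall h, M h -> H2inner (ps_sub f g) h = 0.

Definition is_Wf f W : Prop := is_orthogonal_projection (closure_fP f) ps_one W.

Definition is_optimal_approximant f (n : nat) (p : {poly R[i]}) : Prop :=
  (size p <= n.+1)%N /\
  forall q, (size q <= n.+1)%N ->
    (H2norm (ps_sub (poly_mul p f) ps_one) <=
     H2norm (ps_sub (poly_mul q f) ps_one))%E.

(* The quotient is compared with its extension only off the zeros of [f], where
   the pointwise quotient [W z / f z] is the junk value 0. *)
Definition quotient_singular_on_circle W f : Prop :=
  ~ exists r : R, 1 < r /\ exists h : Cplx R -> Cplx R,
      holomorphic_on (disk r) h /\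
      forall z, disk 1 z -> ps_eval f z != 0 -> h z = ps_eval W z / ps_eval f z.

End Weighted_Hardy_space.

Section Measures_on_the_closed_disk.
Variables (R : realType) (mu : {finite_measure set (Cborel R) -> \bar R}).

Definition carried_by_closed_disk : Prop := mu (~` cdisk 1) = 0%E.

Definition measure_support : set (Cplx R) :=
  [set z | forall U : set (Cplx R), open U -> U z -> (0 < mu U)%E].

Definition rotation_invariant : Prop :=
  forall (u : Cplx R) (A : set (Cborel R)), normc u = 1 -> measurable A ->
    mu [set u * z | z in (A : set (Cplx R))] = mu A.

Definition Cintegral (F : Cplx R -> Cplx R) : Cplx R :=
  (\int[mu]_(z in cdisk 1) complex.Re (F z))%R +i*
  (\int[mu]_(z in cdisk 1) complex.Im (F z))%R.

Definition orthonormal_polynomials (phi : nat -> {poly R[i]}) : Prop :=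
  (forall n, size (phi n) = n.+1) /\
  forall m n, Cintegral (fun z => (phi m).[z] * ((phi n).[z])^*) = (m == n)%:R.

Definition regular_measure : Prop :=
  infinite_set measure_support /\
  exists (phi : nat -> {poly R[i]}) (kappa : nat -> R),
    [/\ orthonormal_polynomials phi,
        forall n, 0 < kappa n /\ lead_coef (phi n) = (kappa n)%:C
      & (kappa n `^ n%:R^-1) @[n --> \oo] --> (1 : R)].

(* On the unit circle the value is the radial limit. *)
Definition boundary_extension (g : nat -> Cplx R) (z : Cplx R) : Cplx R :=
  if normc z == 1 then lim (ps_eval g (r%:C * z) @[r --> (1 : R)^'-])
  else ps_eval g z.

Definition L2norm (g : nat -> Cplx R) : \bar R :=
  sqrte (\int[mu]_(z in cdisk 1) (normc (boundary_extension g z) ^+ 2)%:E)%E.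

End Measures_on_the_closed_disk.

Definition quasi_integral (R : realType) (w : nat -> R) : Prop :=
  exists mu : {finite_measure set (Cborel R) -> \bar R},
    [/\ carried_by_closed_disk mu,
        regular_measure mu,
        rotation_invariant mu
      & exists c1 c2 : R, [/\ 0 < c1, 0 < c2 &
          forall g, H2 w g ->
            (c1%:E * H2norm w g <= L2norm mu g)%E /\
            (L2norm mu g <= c2%:E * H2norm w g)%E]].

(* [closed_field_poly_normal p] is a sequence [s] with
   [p = lead_coef p *: \prod_(z <- s) ('X - z%:P)]: the roots of [p] listed
   with multiplicity. *)
Definition count_zeros (R : realType) (r : R) (p : {poly R[i]}) : nat :=
  count (fun z => normc z <= r) (sval (closed_field_poly_normal p)).

(* Main.v *)
(* Write ||.|| for the norm of H^2_w and a_n for the coefficient of z^n in p_n.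

   Since w_n / w_(n+1) -> 1, an element of norm at most 1 is bounded on every
   circle |z| = r < 1, and ||z^n f|| grows subexponentially.  Landau's inequality
   for Mahler measures, applied to p_n f on |z| = r, bounds
   |a_n| |f(0)| prod max(r, |z_j|), the product being over the zeros z_j of p_n;
   so if a fixed proportion of the zeros lie in |z| > 1 + eps for all large n,
   then a_n decays geometrically.  Minimality of p_n and p_(n+1) gives
   ||(p_(n+1) - p_n) f|| <= |a_(n+1)| ||z^(n+1) f||, which decays geometrically too.
   To pass from (p_(n+1) - p_n) f to p_(n+1) - p_n without exponential loss,
   choose r close to 1 such that f has no zero on |z| = r (by Jensen's bound f
   has finitely many zeros in smaller disks): f is bounded below on this circle
   and Cauchy's estimate applies.  Hence the coefficients of p_n converge to
   those of a series with radius of convergence larger than 1.  As p_n f -> W_f,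
   this series extends W_f / f across the unit circle. *)

Require Import Defs.
From mathcomp Require Import all_boot all_order all_algebra.
From mathcomp Require Import all_classical all_reals all_analysis.
From mathcomp Require Import cyclic separable cyclotomic.
From mathcomp Require Import ring lra zify.
Import Order.TTheory GRing.Theory Num.Theory.
Import numFieldNormedType.Exports.
Local Open Scope classical_set_scope.
Local Open Scope ring_scope.
Local Open Scope complex_scope.

Set Implicit Arguments.
Unset Strict Implicit.
Unset Printing Implicit Defensive.

(** * Modulus and convergence in the complex plane *)

Section Modulus.
Variable R : realType.
Implicit Types (x y z : R[i]) (u : nat -> Cplx R).

Lemma normE_normc z : `|z| = (normc z)%:C.
Proof. by []. Qed.

Lemma normc_ge0 z : 0 <= normc z.
Proof. by case: z => a b; exact: sqrtr_ge0. Qed.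

Lemma normcD_le x y : normc (x + y) <= normc x + normc y.
Proof. exact: le_normcD. Qed.

Lemma normc_opp x : normc (- x) = normc x.
Proof. exact: normcN. Qed.

Lemma normcB_le x y : normc (x - y) <= normc x + normc y.
Proof. by rewrite (le_trans (normcD_le _ _))// normc_opp. Qed.

Lemma normc_distC x y : normc (x - y) = normc (y - x).
Proof. by rewrite -normc_opp opprB. Qed.

Lemma normcX x n : normc (x ^+ n) = normc x ^+ n.
Proof. by elim: n => [|n IH]; rewrite ?Normc.normc1// !exprS Normc.normcM IH. Qed.

Lemma normc_eq0 x : (normc x == 0) = (x == 0).
Proof.
apply/eqP/eqP => [/Normc.eq0_normc//|->]; exact: Normc.normc0.
Qed.

Lemma normc_gt0 x : (0 < normc x) = (x != 0).
Proof. by rewrite lt_def normc_ge0 andbT normc_eq0. Qed.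

Lemma normc_real (a : R) : normc (a%:C) = `|a|.
Proof. by rewrite /= expr0n addr0 sqrtr_sqr. Qed.

Lemma normc_nat n : normc (n%:R : R[i]) = n%:R.
Proof. by rewrite -(rmorph_nat (real_complex R)) normc_real ger0_norm. Qed.

Lemma sqr_normcE z : normc z ^+ 2 = complex.Re z ^+ 2 + complex.Im z ^+ 2.
Proof. by case: z => a b /=; rewrite sqr_sqrtr// addr_ge0 ?sqr_ge0. Qed.

Lemma Re_le_normc z : `|complex.Re z| <= normc z.
Proof.
rewrite -(@ler_pXn2r _ 2)// ?nnegrE ?normc_ge0// sqr_normcE real_normK ?num_real//.
by rewrite lerDl sqr_ge0.
Qed.

Lemma Im_le_normc z : `|complex.Im z| <= normc z.
Proof.
rewrite -(@ler_pXn2r _ 2)// ?nnegrE ?normc_ge0// sqr_normcE real_normK ?num_real//.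
by rewrite lerDr sqr_ge0.
Qed.

Lemma normc_le_ReIm z : normc z <= `|complex.Re z| + `|complex.Im z|.
Proof.
rewrite -(@ler_pXn2r _ 2)// ?nnegrE ?normc_ge0 ?addr_ge0// sqr_normcE.
by rewrite sqrrD !real_normK ?num_real// addrAC lerDl mulrn_wge0// mulr_ge0.
Qed.

Lemma normc_sum (I : Type) (s : seq I) (P : pred I) (F : I -> R[i]) :
  normc (\sum_(i <- s | P i) F i) <= \sum_(i <- s | P i) normc (F i).
Proof.
elim/big_rec2: _ => [|i y1 y2 _ h]; first by rewrite Normc.normc0.
by rewrite (le_trans (normcD_le _ _))// lerD2l.
Qed.

Lemma cvgC_lt (T : Type) (F : set_system T) {FF : Filter F}
    (u : T -> Cplx R) (l : Cplx R) :
  u x @[x --> F] --> l <->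
  forall e : R, 0 < e -> \forall x \near F, normc (l - u x) < e.
Proof.
rewrite cvgrPdist_lt; split => H e e0.
  have /H : (0 : R[i]) < e%:C by rewrite ltcR.
  by apply: filterS => x; rewrite normE_normc ltcR.
have er : e \is Num.real by rewrite realE (ltW e0).
rewrite -(RRe_real er) in e0 *; move: e0; rewrite ltcR => /H.
by apply: filterS => x; rewrite normE_normc ltcR.
Qed.

Lemma cvgC_dominated (T : Type) (F : set_system T) {FF : Filter F}
    (u : T -> Cplx R) (l : Cplx R) (b : T -> R) :
  (\forall x \near F, normc (l - u x) <= b x) -> b x @[x --> F] --> (0 : R) ->
  u x @[x --> F] --> l.
Proof.
move=> H /cvgrPdist_lt b0; apply/cvgC_lt => e e0.
have be := b0 e e0; near=> x.
have h1 : normc (l - u x) <= b x by near: x.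
have h2 : `|0 - b x| < e by near: x.
by rewrite (le_lt_trans h1)// (le_lt_trans _ h2)// sub0r normrN ler_norm.
Unshelve. all: by end_near. Qed.

Lemma normc_cvg_to (T : Type) (F : set_system T) {FF : Filter F}
    (u : T -> Cplx R) (l : Cplx R) :
  u x @[x --> F] --> l -> normc (u x) @[x --> F] --> normc l.
Proof.
move=> /cvgC_lt H; apply/cvgrPdist_lt => e /H; apply: filterS => n.
apply: le_lt_trans; rewrite ler_norml; apply/andP; split.
  rewrite lerNl opprB lerBlDr -[X in normc X](subrK l) normc_distC.
  exact: normcD_le.
by rewrite lerBlDr -[X in normc X <= _](subrK (u n)) normcD_le.
Qed.

Lemma normc_lim_le (u : nat -> Cplx R) (l : Cplx R) (M : R) :
  u @ \oo --> l -> (\forall n \near \oo, normc (u n) <= M) -> normc l <= M.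
Proof. by move=> /normc_cvg_to ul uM; exact: (cvgr_to_le ul uM). Qed.

Lemma cvgC_unique (u : nat -> Cplx R) (l l' : Cplx R) :
  u @ \oo --> l -> u @ \oo --> l' -> l = l'.
Proof. by move=> h1 h2; apply: (cvg_unique _ h1 h2); exact: norm_hausdorff. Qed.

Lemma cvgC_lim (u : nat -> Cplx R) (l : Cplx R) :
  u @ \oo --> l -> limn u = l.
Proof. by move=> h; apply: cvg_lim => //; exact: norm_hausdorff. Qed.

Lemma cvgC_ReIm (T : Type) (F : set_system T) {FF : Filter F}
    (u : T -> Cplx R) (a b : R) :
  complex.Re (u x) @[x --> F] --> a -> complex.Im (u x) @[x --> F] --> b ->
  u x @[x --> F] --> (a +i* b : Cplx R).
Proof.
move=> ua ub; apply: (@cvgC_dominated _ F _ _ _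
  (fun n => `|a - complex.Re (u n)| + `|b - complex.Im (u n)|)).
  near=> n; apply: le_trans (normc_le_ReIm _) _.
  by rewrite !raddfB.
have dist0 (v : T -> R) c : v x @[x --> F] --> c -> `|c - v x| @[x --> F] --> (0 : R).
  move=> vc; have := cvg_norm (cvgB (cvg_cst c) vc); rewrite subrr normr0; exact.
have := cvgD (dist0 _ _ ua) (dist0 _ _ ub); rewrite addr0; exact.
Unshelve. all: by end_near. Qed.

Lemma geometric_cvg0 (C t : R) : 0 <= t -> t < 1 ->
  (fun n => C * t ^+ n) @ \oo --> (0 : R).
Proof. by move=> t0 t1; apply: cvg_geometric; rewrite ger0_norm. Qed.

Lemma series_geometric_le (C t : R) n : 0 <= C -> 0 <= t -> t < 1 ->
  \sum_(k < n) C * t ^+ k <= C / (1 - t).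
Proof.
move=> C0 t0 t1; rewrite -mulr_sumr; apply: ler_wpM2l => //.
have t1' : 0 < 1 - t by rewrite subr_gt0.
rewrite -[leRHS]mul1r ler_pdivlMr// mulrC -opprB mulNr -subrX1 opprB.
by rewrite gerBl exprn_ge0.
Qed.

(** Convergence comes from comparison on the real and imaginary parts separately; the tail bound is
    the limit of bounds on differences of partial sums. At [n = 0] it bounds the sum of the series
    itself. *)
Lemma cvg_series_geometric (u : nat -> Cplx R) (C t : R) :
  0 <= t -> t < 1 -> (forall n, normc (u n) <= C * t ^+ n) ->
  exists2 l : Cplx R, series u @ \oo --> l &
    forall n, normc (l - series u n) <= C * t ^+ n / (1 - t).
Proof.
move=> t0 t1 uC.
have C0 : 0 <= C by rewrite -[C]mulr1 -(expr0 t) (le_trans (normc_ge0 _) (uC 0)).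
have cv (v : nat -> R) : (forall n, `|v n| <= normc (u n)) -> cvgn (series v).
  move=> vu; apply: normed_cvg; apply: (@series_le_cvg _ _ (geometric C t)).
  - by move=> n; exact: normr_ge0.
  - by move=> n /=; rewrite mulr_ge0// exprn_ge0.
  - by move=> n /=; exact: le_trans (vu n) (uC n).
  - by apply: is_cvg_geometric_series; rewrite ger0_norm.
have [a ua] : exists a : R, series (fun n => complex.Re (u n)) @ \oo --> a.
  by eexists; apply: cv => n; exact: Re_le_normc.
have [b ub] : exists b : R, series (fun n => complex.Im (u n)) @ \oo --> b.
  by eexists; apply: cv => n; exact: Im_le_normc.
have ul : series u @ \oo --> (a +i* b : Cplx R).
  apply: cvgC_ReIm.
    suff -> : (fun n => complex.Re (series u n)) = series (fun n => complex.Re (u n)) by [].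
    by apply/funext => n; rewrite /series/= raddf_sum.
  suff -> : (fun n => complex.Im (series u n)) = series (fun n => complex.Im (u n)) by [].
  by apply/funext => n; rewrite /series/= raddf_sum.
exists (a +i* b) => // n.
have h : (fun m => series u (m + n)%N - series u n) @ \oo --> ((a +i* b) - series u n : Cplx R).
  by apply: cvgB; [rewrite cvg_shiftn|exact: cvg_cst].
apply: normc_lim_le h _; near=> m.
rewrite sub_series_geq ?leq_addl// (le_trans (normc_sum _ _ _))//.
rewrite -[X in index_iota X _](add0n n) big_addn addnK.
apply: le_trans (_ : \sum_(k < m) (C * t ^+ n) * t ^+ k <= _); last first.
  by apply: series_geometric_le => //; rewrite mulr_ge0// exprn_ge0.
rewrite big_mkord ler_sum// => i _.
by rewrite -mulrA -exprD addnC.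
Unshelve. all: by end_near. Qed.

End Modulus.

(** * Power series, coefficient bounds and Cauchy products *)

Section Power_series.
Variable R : realType.
Implicit Types (f g c : nat -> Cplx R) (z : Cplx R).

(** A coefficient form of analyticity in [|z| < rho]: Cauchy's estimate gives it for any function
    bounded there, and it makes the series converge in that disk. *)
Definition cauchy_bound (rho : R) f :=
  exists C : R, forall n, normc (f n) * rho ^+ n <= C.

(** [poly_mul q f] is convertible to the Cauchy product of the coefficient sequence of [q] with [f],
    so the facts below also serve [poly_mul]. *)
Definition cauchy_mul f g : nat -> Cplx R :=
  fun n => \sum_(k < n.+1) f k * g (n - k)%N.

Lemma cauchy_bound_ge0 rho f : cauchy_bound rho f ->
  exists2 C : R, 0 <= C & forall n, normc (f n) * rho ^+ n <= C.
Proof.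
move=> [C fC]; exists C => //; apply: le_trans (fC 0%N).
by rewrite mulr1 normc_ge0.
Qed.

Lemma cauchy_boundW rho rho' f : 0 <= rho' <= rho -> cauchy_bound rho f ->
  cauchy_bound rho' f.
Proof.
move=> /andP[r0 rr] [C fC]; exists C => n; apply: le_trans (fC n).
by rewrite ler_wpM2l ?normc_ge0// lerXn2r// nnegrE (le_trans r0).
Qed.

Lemma cauchy_boundB rho f g : 0 <= rho -> cauchy_bound rho f -> cauchy_bound rho g ->
  cauchy_bound rho (ps_sub f g).
Proof.
move=> r0 [C fC] [D gD]; exists (C + D) => n; apply: le_trans (lerD (fC n) (gD n)).
by rewrite -mulrDl ler_wpM2r ?exprn_ge0// normcB_le.
Qed.

Lemma cauchy_bound_poly rho (q : {poly R[i]}) : 0 <= rho ->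
  cauchy_bound rho (fun n => q`_n).
Proof.
move=> r0; exists (\sum_(i < size q) normc q`_i * rho ^+ i) => n.
have F0 i : 0 <= normc q`_i * rho ^+ i by rewrite mulr_ge0 ?normc_ge0 ?exprn_ge0.
have [nq|qn] := ltnP n (size q); last first.
  by rewrite nth_default// Normc.normc0 mul0r sumr_ge0.
by rewrite (bigD1 (Ordinal nq))//= lerDl sumr_ge0.
Qed.

Lemma term_geometric rho f z C : 0 < rho ->
  (forall n, normc (f n) * rho ^+ n <= C) ->
  forall n, normc (f n * z ^+ n) <= C * (normc z / rho) ^+ n.
Proof.
move=> r0 fC n; rewrite Normc.normcM normcX expr_div_n [leLHS]mulrC mulrCA [C * _]mulrC.
by rewrite ler_wpM2l ?exprn_ge0 ?normc_ge0// ler_pdivlMl ?exprn_gt0// mulrC.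
Qed.

Lemma ps_eval_tail rho f z C : normc z < rho ->
  (forall n, normc (f n) * rho ^+ n <= C) ->
  series (fun n => f n * z ^+ n) @ \oo --> ps_eval f z /\
  forall n, normc (ps_eval f z - series (fun n => f n * z ^+ n) n)
     <= C * (normc z / rho) ^+ n / (1 - normc z / rho).
Proof.
move=> zr fC; have r0 : 0 < rho := le_lt_trans (normc_ge0 z) zr.
have t0 : 0 <= normc z / rho by rewrite divr_ge0 ?normc_ge0// ltW.
have t1 : normc z / rho < 1 by rewrite ltr_pdivrMr ?mul1r.
have [l ul lC] := cvg_series_geometric t0 t1 (term_geometric z r0 fC).
by rewrite /ps_eval (cvgC_lim ul).
Qed.

Lemma ps_eval_cvg rho f z : cauchy_bound rho f -> normc z < rho ->
  series (fun n => f n * z ^+ n) @ \oo --> ps_eval f z.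
Proof. by move=> [C fC] zr; have [] := ps_eval_tail zr fC. Qed.

Lemma ps_eval_norm rho f z C : normc z < rho ->
  (forall n, normc (f n) * rho ^+ n <= C) ->
  normc (ps_eval f z) <= C / (1 - normc z / rho).
Proof.
move=> zr fC; have [_ /(_ 0%N)] := ps_eval_tail zr fC.
by rewrite /series/= big_geq// subr0 mulr1.
Qed.

(** As [0 <= t < 1], each of the [n + 1] copies of [t ^+ n] is at most a term of the sum
    [1 + t + ... + t ^+ n]. *)
Lemma mulSn_geometric_le (t : R) n : 0 <= t -> t < 1 ->
  n.+1%:R * t ^+ n <= (1 - t)^-1.
Proof.
move=> t0 t1; have := series_geometric_le n.+1 ler01 t0 t1; rewrite mul1r.
apply: le_trans; rewrite -[n.+1 in leLHS]card_ord -sum1_card natr_sum mulr_suml.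
by apply: ler_sum => i _; rewrite !mul1r ler_wiXn2l ?(ltW t1)// -ltnS.
Qed.

(** A linear factor is absorbed by a larger ratio: [t'] is halfway between [t] and 1, and the
    previous bound is applied to [t / t']. *)
Lemma mulSn_geometric_dominated (t : R) : 0 <= t -> t < 1 ->
  exists2 t', 0 <= t' < 1 &
  exists2 C, 0 <= C & forall n, n.+1%:R * t ^+ n <= C * t' ^+ n.
Proof.
move=> t0 t1; have t'0 : 0 < (1 + t) / 2 by lra.
exists ((1 + t) / 2); first by apply/andP; split; lra.
have s0 : 0 <= t / ((1 + t) / 2) by rewrite divr_ge0// ltW.
have s1 : t / ((1 + t) / 2) < 1 by rewrite ltr_pdivrMr// mul1r; lra.
exists (1 - t / ((1 + t) / 2))^-1; first by rewrite invr_ge0 subr_ge0 ltW.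
move=> n; rewrite -ler_pdivrMr ?exprn_gt0// -mulrA -expr_div_n.
exact: mulSn_geometric_le.
Qed.

Lemma cauchy_mul_coef_le rho f g C D n : 0 < rho ->
  (forall n, normc (f n) * rho ^+ n <= C) ->
  (forall n, normc (g n) * rho ^+ n <= D) ->
  normc (cauchy_mul f g n) * rho ^+ n <= C * D * n.+1%:R.
Proof.
move=> r0 fC gD; rewrite mulr_natr -[n.+1 in leRHS]card_ord -sumr_const.
apply: le_trans (_ : (\sum_(k < n.+1) normc (f k * g (n - k)%N)) * rho ^+ n <= _).
  by rewrite ler_wpM2r ?exprn_ge0 ?(ltW r0)// normc_sum.
rewrite mulr_suml ler_sum// => i _.
have -> : rho ^+ n = rho ^+ i * rho ^+ (n - i) by rewrite -exprD subnKC// -ltnS.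
by rewrite Normc.normcM mulrACA ler_pM// mulr_ge0 ?normc_ge0// exprn_ge0// ltW.
Qed.

(** The number [n + 1] of summands in a coefficient of the product is paid for by shrinking the
    radius. *)
Lemma cauchy_mul_bound rho rho' f g : 0 <= rho' < rho ->
  cauchy_bound rho f -> cauchy_bound rho g -> cauchy_bound rho' (cauchy_mul f g).
Proof.
move=> /andP[r0' rr'] fb gb; have r0 := le_lt_trans r0' rr'.
have [C C0 fC] := cauchy_bound_ge0 fb; have [D D0 gD] := cauchy_bound_ge0 gb.
have t0 : 0 <= rho' / rho by rewrite divr_ge0// ltW.
have t1 : rho' / rho < 1 by rewrite ltr_pdivrMr ?mul1r.
exists (C * D * (1 - rho' / rho)^-1) => n.
have -> : rho' ^+ n = rho ^+ n * (rho' / rho) ^+ n.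
  by rewrite expr_div_n mulrCA divff ?mulr1// expf_neq0// gt_eqF.
apply: le_trans (_ : C * D * (n.+1%:R * (rho' / rho) ^+ n) <= _).
  by rewrite !mulrA ler_wpM2r ?exprn_ge0// cauchy_mul_coef_le.
by rewrite ler_wpM2l ?mulr_ge0// mulSn_geometric_le.
Qed.

(** The product of the two truncations at degree [K] differs from the truncation of the Cauchy
    product only by terms of degree at least [K], whose sum is geometrically small in [K]. *)
Lemma ps_eval_mul rho f g z : cauchy_bound rho f -> cauchy_bound rho g ->
  normc z < rho -> ps_eval (cauchy_mul f g) z = ps_eval f z * ps_eval g z.
Proof.
move=> fb gb zr; have z0 := normc_ge0 z; have r0 := le_lt_trans z0 zr.
have [C C0 fC] := cauchy_bound_ge0 fb; have [D D0 gD] := cauchy_bound_ge0 gb.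
have fgb : cauchy_bound ((normc z + rho) / 2) (cauchy_mul f g).
  by apply: cauchy_mul_bound fb gb; apply/andP; split; lra.
have zr' : normc z < (normc z + rho) / 2 by lra.
apply: cvgC_unique (ps_eval_cvg fgb zr') _.
have h : (fun K => series (fun n => f n * z ^+ n) K * series (fun n => g n * z ^+ n) K)
    @ \oo --> (ps_eval f z * ps_eval g z : Cplx R).
  by apply: cvgM; [exact: ps_eval_cvg fb zr|exact: ps_eval_cvg gb zr].
have t0 : 0 <= normc z / rho by rewrite divr_ge0// ltW.
have t1 : normc z / rho < 1 by rewrite ltr_pdivrMr ?mul1r.
have [t' /andP[t'0 t'1] [B B0 tB]] := mulSn_geometric_dominated t0 t1.
pose P (f : nat -> Cplx R) K : {poly R[i]} := \poly_(i < K) (f i : R[i]).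
have SP (a : nat -> Cplx R) K : series (fun n => a n * z ^+ n) K = (P a K).[z].
  by rewrite horner_poly /series/= big_mkord.
have Pb (a : nat -> Cplx R) A K : 0 <= A -> (forall n, normc (a n) * rho ^+ n <= A) ->
    forall n, normc (P a K)`_n * rho ^+ n <= A.
  by move=> A0 aA n; rewrite coef_poly; case: ifP => // _; rewrite Normc.normc0 mul0r.
have PP K : normc ((P f K * P g K).[z] - (P (cauchy_mul f g) K).[z])
    <= C * D * B / (1 - t') * t' ^+ K.
  (* Below degree [K], truncating the factors does not change the coefficients of the product. *)
  have -> : P (cauchy_mul f g) K = P (fun n => (P f K * P g K)`_n) K.
    apply/polyP => n; rewrite !coef_poly; case: ifP => // nK.
    rewrite coefM; apply: eq_bigr => i _; rewrite !coef_poly.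
    by rewrite (leq_ltn_trans _ nK)// ?(leq_ltn_trans _ nK)// ?leq_subr// -ltnS.
  have sz : (size (P f K * P g K)%R <= K + K)%N.
    rewrite (leq_trans (size_polyMleq _ _))// (leq_trans (leq_pred _))//.
    by rewrite leq_add// size_poly.
  have -> : (P f K * P g K).[z] - (P (fun n => (P f K * P g K)`_n) K).[z] =
      \sum_(i < K) (P f K * P g K)`_(K + i) * z ^+ (K + i).
    by rewrite (horner_coef_wide _ sz) [in X in _ - X]/P horner_poly big_split_ord/= [X in X - _]addrC -addrA -[RHS]addr0; congr (_ + _); exact: subrr.
  apply: le_trans (normc_sum _ _ _) _.
  apply: le_trans (_ : \sum_(i < K) (C * D * B * t' ^+ K) * t' ^+ i <= _); last first.
    apply: le_trans (series_geometric_le K _ t'0 t'1) _; last by rewrite mulrAC.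
    by rewrite !mulr_ge0// exprn_ge0.
  apply: ler_sum => i _; rewrite -[leRHS]mulrA -exprD.
  have h1 : normc ((P f K * P g K)`_(K + i) * z ^+ (K + i)) <=
     C * D * (K + i).+1%:R * (normc z / rho) ^+ (K + i).
    rewrite Normc.normcM normcX expr_div_n [leLHS]mulrC [leRHS]mulrCA.
    rewrite ler_wpM2l ?exprn_ge0// ler_pdivlMr ?exprn_gt0// coefM.
    exact: (cauchy_mul_coef_le (K + i) r0 (Pb _ _ K C0 fC) (Pb _ _ K D0 gD)).
  apply: le_trans h1 _.
  by rewrite -!mulrA ler_wpM2l// ler_wpM2l// tB.
have d0 : (fun K => (P f K * P g K).[z] - (P (cauchy_mul f g) K).[z] : Cplx R)
    @ \oo --> (0 : Cplx R).
  apply: (@cvgC_dominated _ _ \oo _ _ _ _ _ (geometric_cvg0 (C * D * B / (1 - t')) t'0 t'1)).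
  by near=> K; rewrite sub0r normc_opp.
rewrite -[X in _ --> X]subr0; apply: cvg_trans (cvgB h d0).
apply: near_eq_cvg; near=> K.
by rewrite !fctE !SP hornerM opprB addrC subrK.
Unshelve. all: by end_near. Qed.

End Power_series.

(** * Division by linear factors, continuity and differentiability *)

Section Division.
Variable R : realType.
Implicit Types (f g c : nat -> Cplx R) (z a : Cplx R) (q : {poly R[i]}).

Lemma ps_evalB rho f g z : cauchy_bound rho f -> cauchy_bound rho g ->
  normc z < rho -> ps_eval (ps_sub f g) z = ps_eval f z - ps_eval g z.
Proof.
move=> fb gb zr; apply: cvgC_lim.
suff -> : series (fun n => ps_sub f g n * z ^+ n : Cplx R) =
    (fun n => series (fun n => f n * z ^+ n : Cplx R) n -
              series (fun n => g n * z ^+ n : Cplx R) n).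
  by apply: cvgB; [exact: ps_eval_cvg fb zr|exact: ps_eval_cvg gb zr].
apply/funext => n; rewrite /series/= -sumrB; apply: eq_bigr => i _.
by rewrite -mulrBl.
Qed.

Lemma ps_eval_poly q z : ps_eval (fun n => q`_n) z = q.[z].
Proof.
apply: cvgC_lim; apply: cvg_near_cst; near=> n.
rewrite /series/= big_mkord -horner_coef_wide//; near: n.
by exists (size q).
Unshelve. all: by end_near. Qed.

Lemma ps_eval_poly_mul rho q f z : cauchy_bound rho f -> normc z < rho ->
  ps_eval (poly_mul q f) z = q.[z] * ps_eval f z.
Proof.
move=> fb zr; rewrite -ps_eval_poly -(@ps_eval_mul _ rho)//.
by apply: cauchy_bound_poly; rewrite ltW// (le_lt_trans _ zr)// normc_ge0.
Qed.

Lemma ps_eval_shift rho f z : cauchy_bound rho f -> normc z < rho ->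
  ps_eval f z = f 0%N + z * ps_eval (fun n => f n.+1) z.
Proof.
move=> [C fC] zr; have r0 : 0 < rho := le_lt_trans (normc_ge0 z) zr.
have fb' : cauchy_bound rho (fun n => f n.+1).
  by exists (C / rho) => n; rewrite ler_pdivlMr// -mulrA -exprSr.
apply: (@cvgC_unique _ (fun n => series (fun n => f n * z ^+ n : Cplx R) n.+1)).
  by rewrite (cvg_shiftS (series _)); apply: ps_eval_cvg zr; exists C.
suff -> : (fun n => series (fun n => f n * z ^+ n : Cplx R) n.+1) =
   (fun n => f 0%N + z * series (fun n => f n.+1 * z ^+ n : Cplx R) n : Cplx R).
  apply: cvgD; first exact: cvg_cst.
  by apply: cvgM; [exact: cvg_cst|exact: ps_eval_cvg fb' zr].
apply/funext => n; rewrite /series/= big_nat_recl// mulr1 mulr_sumr.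
by congr (_ + _); apply: eq_bigr => i _; rewrite exprS mulrCA.
Qed.

Lemma poly_mul_linear q g n : (size q <= 2)%N ->
  poly_mul q g n = q`_0 * g n + (if n is m.+1 then q`_1 * g m else 0).
Proof.
move=> sq; case: n => [|n]; first by rewrite /poly_mul big_ord1 addr0.
rewrite /poly_mul !big_ord_recl/= subn0 subSS subn0 big1 ?addr0// => i _.
by rewrite nth_default ?mul0r// (leq_trans sq).
Qed.

(** Synthetic division: the coefficients [b n = sum_j f (n + 1 + j) a^j] satisfy
    [b (n - 1) - a * b n = f n] for [n > 0]. The radius [rho] is not reduced, so divisions can be
    iterated. *)
Lemma ps_division rho f a : cauchy_bound rho f -> normc a < rho ->
  exists2 g, cauchy_bound rho g &
    ps_sub f (fun n => (ps_eval f a)%:P`_n) = poly_mul ('X - a%:P) g.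
Proof.
move=> fb ar; have r0 : 0 < rho := le_lt_trans (normc_ge0 a) ar.
have [C C0 fC] := cauchy_bound_ge0 fb.
have shC n j : normc (f (n + j)%N) * rho ^+ j <= C / rho ^+ n.
  by rewrite ler_pdivlMr ?exprn_gt0// -mulrA -exprD addnC.
exists (fun n => ps_eval (fun j => f (n.+1 + j)%N) a).
  exists (C / rho / (1 - normc a / rho)) => n.
  rewrite -ler_pdivlMr ?exprn_gt0//.
  apply: le_trans (ps_eval_norm ar (shC n.+1)) _.
  by rewrite exprS invfM mulrA mulrAC.
apply/funext => n; rewrite poly_mul_linear ?size_XsubC//.
rewrite !coefB !coefX !coefC/= sub0r subr0 mulNr.
have E m : ps_eval (fun j => f (m + j)%N) a =
    f m + a * ps_eval (fun j => f (m.+1 + j)%N) a.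
  rewrite (@ps_eval_shift rho)//; last by exists (C / rho ^+ m).
  rewrite addn0; congr (_ + _ * ps_eval _ _); apply/funext => j.
  by rewrite addSnnS.
rewrite /ps_sub coefC; case: n => [|n] /=; last by rewrite subr0 mul1r [X in _ + X]E addrC addrK.
by rewrite (_ : f = (fun j => f (0 + j)%N))// E opprD addNKr addr0.
Qed.

Lemma ps_division_eval rho f a : cauchy_bound rho f -> normc a < rho ->
  exists2 g, cauchy_bound rho g &
    forall z, normc z < rho -> ps_eval f z - ps_eval f a = (z - a) * ps_eval g z.
Proof.
move=> fb ar; have [g gb fg] := ps_division fb ar; exists g => // z zr.
have r0 : 0 <= rho by rewrite ltW// (le_lt_trans (normc_ge0 a)).
have := ps_eval_poly_mul ('X - a%:P) gb zr; rewrite -fg hornerXsubC => <-.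
by rewrite (ps_evalB fb (cauchy_bound_poly _ r0) zr) ps_eval_poly hornerC.
Qed.

(** The quotient by [z - a] is bounded on [|z| <= (|a| + rho) / 2], and [d] is chosen to keep [z] in
    that disk. *)
Lemma ps_eval_lipschitz rho f a : cauchy_bound rho f -> normc a < rho ->
  exists2 d : R, 0 < d & exists M : R, forall z, normc (z - a) < d ->
    normc z < rho /\ normc (ps_eval f a - ps_eval f z) <= M * normc (z - a).
Proof.
move=> fb ar; have r0 : 0 < rho := le_lt_trans (normc_ge0 a) ar.
have [g gb fg] := ps_division_eval fb ar.
have [C C0 gC] := cauchy_bound_ge0 gb.
exists ((rho - normc a) / 2); first by rewrite divr_gt0// subr_gt0.
exists (C / (1 - (normc a + rho) / 2 / rho)) => z zd.
have za : normc z <= (normc a + rho) / 2.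
  have h : normc z <= normc (z - a) + normc a.
    by rewrite -[X in normc X <= _](subrK a); exact: normcD_le.
  by move: h zd; set x := normc (z - a); lra.
have zr : normc z < rho by lra.
split=> //; rewrite normc_distC fg// Normc.normcM mulrC.
rewrite ler_wpM2r ?normc_ge0// (le_trans (ps_eval_norm zr gC))//.
have ar' : (normc a + rho) / 2 / rho < 1 by rewrite ltr_pdivrMr// mul1r; lra.
rewrite ler_wpM2l// lef_pV2 ?posrE ?subr_gt0//.
  by rewrite lerB// ler_wpM2r// invr_ge0 ltW.
by rewrite ltr_pdivrMr// mul1r.
Qed.

Lemma near_normcB a (e : R) : 0 < e -> \forall z \near nbhs a, normc (z - a) < e.
Proof.
move=> e0; have /cvgC_lt/(_ e e0) : (z : Cplx R) @[z --> a] --> a by exact: cvg_id.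
by apply: filterS => z; rewrite normc_distC.
Qed.

Lemma lipschitz_cvg (T : Type) (F : set_system T) {FF : Filter F}
    (u : T -> Cplx R) (l : Cplx R) (b : T -> Cplx R) (M : R) :
  (\forall x \near F, normc (l - u x) <= M * normc (b x)) ->
  (forall e : R, 0 < e -> \forall x \near F, normc (b x) < e) ->
  u x @[x --> F] --> l.
Proof.
move=> uM b0; apply/cvgC_lt => e e0.
(* [M] has no assigned sign, and [|M| + 1] is a positive number above it. *)
have M1 : 0 < `|M| + 1 by rewrite ltr_wpDl.
have be := b0 (e / (`|M| + 1)) (divr_gt0 e0 M1).
near=> x; apply: le_lt_trans (_ : (`|M| + 1) * normc (b x) < e).
  have h : normc (l - u x) <= M * normc (b x) by near: x.
  apply: le_trans h _; rewrite ler_wpM2r ?normc_ge0//.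
  by rewrite (le_trans (ler_norm _))// lerDl.
by rewrite mulrC -ltr_pdivlMr//; near: x.
Unshelve. all: by end_near. Qed.

Lemma ps_eval_continuous rho f a : cauchy_bound rho f -> normc a < rho ->
  ps_eval f z @[z --> a] --> ps_eval f a.
Proof.
move=> fb ar; have [d d0 [M fM]] := ps_eval_lipschitz fb ar.
apply: (lipschitz_cvg (F := nbhs a) (b := fun z => z - a) (M := M)).
  by apply: (filterS _ (near_normcB a d0)) => z /fM[].
by move=> e e0; exact: near_normcB.
Qed.

(** The difference quotient at [a] is [ps_eval g (h + a)] for the quotient series [g], which is
    continuous at [a]. *)
Lemma ps_eval_derivable rho f a : cauchy_bound rho f -> normc a < rho ->
  derivable (ps_eval f : Cplx R -> Cplx R) a 1.
Proof.
move=> fb ar; have [g gb fg] := ps_division_eval fb ar.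
have [d d0 [M gM]] := ps_eval_lipschitz gb ar.
apply/cvg_ex; exists (ps_eval g a).
have h0 (e : R) : 0 < e -> \forall h \near (0 : Cplx R)^', normc h < e.
  move=> e0; apply: nbhs_dnbhs; apply: (filterS _ (near_normcB 0 e0)) => h.
  by rewrite subr0.
apply: (lipschitz_cvg (F := (0 : Cplx R)^') (b := id) (M := M)) => //.
have hn0 : \forall h \near (0 : Cplx R)^', h != 0 by exact: nbhs_dnbhs_neq.
have hd := h0 d d0.
near=> h.
have hne : h != 0 by near: h.
have /gM[ha] : normc (h + a - a) < d by rewrite addrK; near: h.
rewrite addrK => gh; suff -> : h^-1 *: (ps_eval f (h *: 1 + a) - ps_eval f a) = ps_eval g (h + a).
  exact: gh.
have -> : h *: 1 + a = h + a :> Cplx R by rewrite /GRing.scale/= mulr1.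
by rewrite fg// addrK /GRing.scale/= mulrA mulVf// mul1r.
Unshelve. all: by end_near. Qed.

End Division.

(** * Landau's inequality, Jensen's bound and zero-free circles *)

Section Landau.
Variable R : realType.
Implicit Types (f g c : nat -> Cplx R) (z a : R[i]) (p q : {poly R[i]}) (r rho : R).

(** Coefficients below [N] see only a truncation of [g], so identities for [poly_mul] are inherited
    from the polynomial ring. *)
Lemma poly_mul_trunc q g N n : (n < N)%N ->
  poly_mul q g n = (q * \poly_(i < N) (g i : R[i]))`_n.
Proof.
move=> nN; rewrite coefM; apply: eq_bigr => i _.
by rewrite coef_poly (leq_ltn_trans (leq_subr _ _) nN).
Qed.

Lemma poly_mulA p q g : poly_mul (p * q) g = poly_mul p (poly_mul q g).
Proof.
apply/funext => n; rewrite (poly_mul_trunc _ _ (ltnSn n)) -mulrA coefM.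
apply: eq_bigr => i _; congr (_ * _); rewrite -poly_mul_trunc//.
by rewrite ltnS leq_subr.
Qed.

Lemma poly_mul0 q g : poly_mul q g 0%N = q`_0 * g 0%N.
Proof. by rewrite /poly_mul big_ord1. Qed.

Lemma poly_mul1 g : poly_mul 1 g = g.
Proof.
apply/funext => n; rewrite (poly_mul_trunc _ _ (ltnSn n)) mul1r coef_poly.
by rewrite ltnSn.
Qed.

Lemma poly_mul_bound rho rho' q g : 0 <= rho' < rho -> cauchy_bound rho g ->
  cauchy_bound rho' (poly_mul q g).
Proof.
move=> rr gb; apply: (cauchy_mul_bound rr _ gb); apply: cauchy_bound_poly.
by have /andP[h /ltW] := rr; exact: le_trans.
Qed.

(** By Parseval, this says that the mean of [|g|^2] over the circle [|z| = r] is at most [C];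
    partial sums avoid integration. *)
Definition l2_bound r g (C : R) :=
  forall K, \sum_(k < K) (normc (g k) * r ^+ k) ^+ 2 <= C.

(** The quotient of [z - a] by this polynomial is the Blaschke factor of the disk [|z| < r] with
    zero [a]. Its value at 0 is [r], against [- a] for [z - a]. *)
Definition blaschke_factor r a : {poly R[i]} := r%:C%:P - (a^* / r%:C) *: 'X.

(** Both squares have the same cross term. With [x], [y] consecutive coefficients and [s] a power of
    [r], the last term is an increment of a telescoping sum. *)
Lemma blaschke_identity r (s : R) a (x y : R[i]) : r != 0 ->
  (normc (r%:C * x - a^* / r%:C * y) * (r * s)) ^+ 2 =
  (normc (y - a * x) * (r * s)) ^+ 2 +
  (r ^+ 2 - normc a ^+ 2) * ((normc x * (r * s)) ^+ 2 - (normc y * s) ^+ 2).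
Proof.
move=> r0; rewrite !exprMn !sqr_normcE.
have -> : a^* / r%:C = a^* * r^-1%:C by rewrite fmorphV.
by case: a x y => [a1 a2] [x1 x2] [y1 y2] /=; field.
Qed.

Lemma size_blaschke_factor r a : (size (blaschke_factor r a) <= 2)%N.
Proof.
rewrite (leq_trans (size_polyD _ _))// geq_max (leq_trans (size_polyC_leq1 _))//.
by rewrite size_polyN (leq_trans (size_scale_leq _ _))// size_polyX.
Qed.

(* On |z| = r the two factors have the same modulus; on coefficients this is a
   telescoping sum. *)
Lemma blaschke_swap r rho a g C : 0 < r < rho -> cauchy_bound rho g ->
  l2_bound r (poly_mul ('X - a%:P) g) C ->
  l2_bound r (poly_mul (blaschke_factor r a) g) C.
Proof.
move=> /andP[r0 rr] /cauchy_bound_ge0[B B0 gB] FC K; have rho0 := lt_trans r0 rr.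
pose A k := (normc (g k) * r ^+ k) ^+ 2.
have E n : \sum_(k < n.+1) (normc (poly_mul (blaschke_factor r a) g k) * r ^+ k) ^+ 2 =
    \sum_(k < n.+1) (normc (poly_mul ('X - a%:P) g k) * r ^+ k) ^+ 2
      + (r ^+ 2 - normc a ^+ 2) * A n.
  have co0 : (blaschke_factor r a)`_0 = r%:C.
    by rewrite coefB coefC coefZ coefX mulr0 subr0.
  have co1 : (blaschke_factor r a)`_1 = - (a^* / r%:C).
    by rewrite coefB coefC coefZ coefX mulr1 sub0r.
  elim: n => [|n IH].
    rewrite !big_ord1 !poly_mul0 co0 coefB coefX coefC sub0r /A !expr0 !mulr1.
    rewrite !Normc.normcM normc_opp normc_real !exprMn real_normK ?num_real//; ring.
  rewrite big_ord_recr/= {}IH [X in _ = X + _]big_ord_recr/= -!addrA; congr (_ + _).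
  rewrite !poly_mul_linear ?size_blaschke_factor ?size_XsubC// co0 co1.
  rewrite !coefB !coefX !coefC/= sub0r subr0 mul1r mulNr.
  have := blaschke_identity (r ^+ n) a (g n.+1) (g n) (lt0r_neq0 r0).
  rewrite -exprS => ->; rewrite [_ + g n]addrC mulNr; rewrite /A; ring.
have t0 : 0 <= r / rho by rewrite divr_ge0// ltW.
have t1 : r / rho < 1 by rewrite ltr_pdivrMr ?mul1r.
have AB k : A k <= B ^+ 2 * ((r / rho) ^+ 2) ^+ k.
  have h : normc (g k) * r ^+ k <= B * (r / rho) ^+ k.
    have : normc (g k) * rho ^+ k * (r / rho) ^+ k <= B * (r / rho) ^+ k.
      by rewrite ler_wpM2r// exprn_ge0.
    by rewrite -mulrA -exprMn [rho * _]mulrC divfK// gt_eqF.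
  by rewrite -exprM mulnC exprM -exprMn lerXn2r// nnegrE mulr_ge0 ?normc_ge0 ?exprn_ge0// ltW.
pose D := `|r ^+ 2 - normc a ^+ 2| * B ^+ 2.
(* The boundary term left by the telescoping vanishes in the limit because [r < rho]. *)
have v_cvg : (fun n => C + D * ((r / rho) ^+ 2) ^+ n) @ \oo --> C.
  rewrite -[X in _ --> X]addr0; apply: cvgD; first exact: cvg_cst.
  by apply: geometric_cvg0; rewrite ?exprn_ge0// exprn_ilt1.
apply: (cvgr_to_ge v_cvg); near=> n.
have Kn : (K <= n.+1)%N by near: n; exists K => // m /= /leqW.
apply: le_trans (_ : \sum_(k < n.+1)
    (normc (poly_mul (blaschke_factor r a) g k) * r ^+ k) ^+ 2 <= _).
  rewrite -(subnKC Kn) big_split_ord/= lerDl sumr_ge0// => i _; exact: sqr_ge0.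
rewrite E lerD// (le_trans (ler_norm _))// normrM -mulrA.
by rewrite ler_wpM2l// ger0_norm ?sqr_ge0.
Unshelve. all: by end_near. Qed.

(** Each linear factor is absorbed into [g]: unchanged if [|a| >= r], where it multiplies [|g 0|] by
    [|a|], and swapped for the Blaschke factor if [|a| < r], where it multiplies [|g 0|] by [r].
    Once no root is left, the first term of the sum gives the bound. Each absorption costs some
    radius, from [rho] to the midpoint of [r] and [rho]. *)
Lemma landau_inequality (s : seq R[i]) r rho g C : 0 < r < rho ->
  cauchy_bound rho g ->
  l2_bound r (poly_mul (\prod_(a <- s) ('X - a%:P)) g) C ->
  ((\prod_(a <- s) Num.max r (normc a)) * normc (g 0%N)) ^+ 2 <= C.
Proof.
elim: s rho g => [|a s IH] rho g /andP[r0 rr] gb.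
  by rewrite !big_nil poly_mul1 mul1r => /(_ 1%N); rewrite big_ord1 mulr1.
rewrite !big_cons => FC.
have rr1 : 0 < r < (r + rho) / 2 by rewrite r0/=; lra.
have rr2 : 0 <= (r + rho) / 2 < rho by apply/andP; split; lra.
rewrite [X in X * _]mulrC -mulrA; have [ra|ra] := lerP r (normc a).
  have := IH _ _ rr1 (poly_mul_bound ('X - a%:P) rr2 gb).
  rewrite -poly_mulA [X in poly_mul X g]mulrC => /(_ FC).
  by rewrite poly_mul0 Normc.normcM coefB coefX coefC sub0r normc_opp.
move: FC; rewrite poly_mulA => /(blaschke_swap rr1 (poly_mul_bound _ rr2 gb)).
rewrite -poly_mulA mulrC poly_mulA => FC.
have := IH _ _ rr1 (poly_mul_bound _ rr2 gb) FC.
rewrite poly_mul0 Normc.normcM coefB coefC coefZ coefX mulr0 subr0.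
by rewrite normc_real gtr0_norm.
Qed.

(** The roots are distinct, so after division by [X - a] the other roots are still zeros of the
    quotient. *)
Lemma prod_division rho f (s : seq R[i]) : cauchy_bound rho f -> uniq s ->
  (forall a, a \in s -> normc a < rho /\ ps_eval f a = 0) ->
  exists2 g, cauchy_bound rho g & f = poly_mul (\prod_(a <- s) ('X - a%:P)) g.
Proof.
elim: s f => [|a s IH] f fb.
  by exists f => //; rewrite big_nil poly_mul1.
move=> /=/andP[as_ us] sf.
have [ar fa] := sf a (mem_head _ _).
have [g gb fg] := ps_division fb ar.
have {}fg : f = poly_mul ('X - a%:P) g.
  by rewrite -fg fa; apply/funext => n; rewrite /ps_sub polyC0 coef0 subr0.
have [] := IH g gb us.
  move=> b bs; have [br fb0] : normc b < rho /\ ps_eval f b = 0.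
    by apply: sf; rewrite inE bs orbT.
  split; first exact: br.
  move: fb0; rewrite fg (ps_eval_poly_mul _ gb br) hornerXsubC.
  move/eqP; rewrite mulf_eq0 subr_eq0 => /orP[/eqP ba|/eqP gb0]; last exact: gb0.
  by case/negP: as_; rewrite -ba.
move=> h hb gh; exists h => //.
by rewrite big_cons poly_mulA -gh.
Qed.

Lemma cauchy_bound_l2 r rho f : 0 < r < rho -> cauchy_bound rho f ->
  exists C, l2_bound r f C.
Proof.
move=> /andP[r0 rr] /cauchy_bound_ge0[B B0 gB]; have rho0 := lt_trans r0 rr.
have t0 : 0 <= r / rho by rewrite divr_ge0// ltW.
have t1 : r / rho < 1 by rewrite ltr_pdivrMr ?mul1r.
exists (B ^+ 2 / (1 - (r / rho) ^+ 2)) => K.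
apply: le_trans (series_geometric_le K (sqr_ge0 _) (sqr_ge0 _) _); last first.
  by rewrite exprn_ilt1.
apply: ler_sum => k _.
have h : normc (f k) * r ^+ k <= B * (r / rho) ^+ k.
  have : normc (f k) * rho ^+ k * (r / rho) ^+ k <= B * (r / rho) ^+ k.
    by rewrite ler_wpM2r// exprn_ge0.
  by rewrite -mulrA -exprMn [rho * _]mulrC divfK// gt_eqF.
by rewrite -exprM mulnC exprM -exprMn lerXn2r// nnegrE mulr_ge0 ?normc_ge0 ?exprn_ge0// ltW.
Qed.

(** After dividing out the [m] zeros, [|f 0| <= rho1^m |g 0|], while Landau's inequality gives
    [(r^m |g 0|)^2 <= C]. *)
Lemma jensen_bound (s : seq R[i]) rho1 r rho f C : 0 < rho1 -> 0 < r < rho ->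
  cauchy_bound rho f -> uniq s -> rho1 < rho ->
  (forall a, a \in s -> normc a <= rho1 /\ ps_eval f a = 0) ->
  l2_bound r f C ->
  normc (f 0%N) ^+ 2 <= C * ((rho1 / r) ^+ 2) ^+ size s.
Proof.
move=> rho1_0 rr fb us rho1r sf fC; have /andP[r0 _] := rr.
have [|g gb fg] := prod_division fb us.
  by move=> a /sf[ar fa]; split => //; exact: le_lt_trans ar rho1r.
have := landau_inequality (s := s) rr gb; rewrite -fg => /(_ _ fC) h.
have f0 : normc (f 0%N) <= rho1 ^+ size s * normc (g 0%N).
  rewrite fg poly_mul0 Normc.normcM ler_wpM2r ?normc_ge0//.
  rewrite -horner_coef0 horner_prod.
  have : forall a, a \in s -> normc a <= rho1 by move=> a /sf[].
  elim: (s) => [|a s' IH] sr; first by rewrite big_nil Normc.normc1.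
  rewrite big_cons Normc.normcM exprS ler_pM ?normc_ge0//.
    by rewrite hornerXsubC sub0r normc_opp sr// mem_head.
  by apply: IH => b bs; apply: sr; rewrite inE bs orbT.
have g0 : r ^+ size s * normc (g 0%N) <= (\prod_(a <- s) Num.max r (normc a)) * normc (g 0%N).
  rewrite ler_wpM2r ?normc_ge0//; elim: (s) => [|a s' IH]; first by rewrite big_nil.
  by rewrite big_cons exprS ler_pM ?exprn_ge0 ?(ltW r0)// le_max lexx.
have {}h : (r ^+ size s * normc (g 0%N)) ^+ 2 <= C.
  apply: le_trans h; rewrite lerXn2r// nnegrE ?(le_trans _ g0)// mulr_ge0 ?normc_ge0//.
  - by rewrite exprn_ge0// ltW.
  - by rewrite exprn_ge0// ltW.
apply: le_trans (_ : (rho1 ^+ size s * normc (g 0%N)) ^+ 2 <= _).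
  by rewrite lerXn2r// nnegrE ?(le_trans _ f0)// normc_ge0.
rewrite -exprM mulnC exprM expr_div_n [X in _ <= _ * X]exprMn [leRHS]mulrCA exprMn.
rewrite ler_wpM2l ?sqr_ge0// exprVn ler_pdivlMr ?exprn_gt0//.
by rewrite mulrC -exprMn.
Qed.

(** If every circle between the two radii carried a zero, there would be [m] distinct zeros for
    every [m], and Jensen's bound would force [f 0 = 0]. *)
Lemma zero_free_circle rho1 rho2 rho f : 0 < rho1 < rho2 -> rho2 < rho ->
  cauchy_bound rho f -> f 0%N != 0 ->
  exists r, rho1 < r < rho2 /\ forall z : Cplx R, normc z = r -> ps_eval f z != 0.
Proof.
move=> /andP[rho10 rho12] rho2r fb f0; apply: contrapT => nex.
(* A zero on the circle of radius [r]; outside the interval the value 0 is a placeholder, which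
   makes the choice a total function of [r]. *)
have ex r : exists a : Cplx R, rho1 < r < rho2 -> normc a = r /\ ps_eval f a = 0.
  have [rr|] := boolP (rho1 < r < rho2); last by exists 0.
  have : ~ forall z : Cplx R, normc z = r -> ps_eval f z != 0.
    by move=> H; apply: nex; exists r.
  move=> /existsNP[z /not_implyP[zr /negP]]; rewrite negbK => /eqP fz.
  by exists z.
pose al r : R[i] := projT1 (cid (ex r)).
have alP r : rho1 < r < rho2 -> normc (al r) = r /\ ps_eval f (al r) = 0.
  by rewrite /al; case: cid.
(* A radius beyond [rho2], so that the ratio [rho2 / r] in Jensen's bound is below 1. *)
have [r [r2 rr]] : exists r, rho2 < r /\ r < rho.
  by exists ((rho2 + rho) / 2); split; lra.
have r0 : 0 < r by lra.
have rr' : 0 < r < rho by rewrite r0.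
have [C fC] := cauchy_bound_l2 rr' fb.
have J m : normc (f 0%N) ^+ 2 <= C * ((rho2 / r) ^+ 2) ^+ m.
  (* [m] equally spaced radii strictly between [rho1] and [rho2]; distinct radii give distinct
     zeros. *)
  pose rad (i : nat) := rho1 + (rho2 - rho1) * (i.+1%:R / m.+1%:R).
  have rad_in i : (i < m)%N -> rho1 < rad i < rho2.
    move=> im; rewrite /rad; have q0 : 0 < i.+1%:R / m.+1%:R :> R by rewrite divr_gt0.
    have q1 : i.+1%:R / m.+1%:R < 1 :> R by rewrite ltr_pdivrMr// mul1r ltr_nat.
    by rewrite ltrDl mulr_gt0 ?subr_gt0//= -ltrBrDl gtr_pMr ?subr_gt0.
  have -> : m = size [seq al (rad i) | i <- iota 0 m] by rewrite size_map size_iota.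
  apply: (jensen_bound _ rr' fb _ rho2r _ fC) => //; first by lra.
    rewrite map_inj_in_uniq ?iota_uniq// => i j.
    rewrite !mem_iota/= !add0n => im jm /(congr1 (@normc R)).
    have [-> _] := alP _ (rad_in i im); have [-> _] := alP _ (rad_in j jm).
    move=> /addrI/mulfI; rewrite subr_eq0 gt_eqF// => /(_ isT).
    move=> /mulIf; rewrite invr_eq0 pnatr_eq0 => /(_ isT)/eqP.
    by rewrite eqr_nat eqSS => /eqP.
  move=> a /mapP[j]; rewrite mem_iota/= add0n => jm ->.
  have [-> ->] := alP _ (rad_in j jm); split => //.
  by have /andP[_ /ltW] := rad_in j jm.
have : normc (f 0%N) ^+ 2 <= 0.
  have t0 : 0 <= rho2 / r by rewrite divr_ge0; lra.
  have t1 : rho2 / r < 1 by rewrite ltr_pdivrMr// mul1r.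
  have := geometric_cvg0 C (sqr_ge0 (rho2 / r)) _.
  move=> /(_ _)/cvgr_to_ge; apply; first by rewrite exprn_ilt1.
  by near=> m; exact: J.
by rewrite leNgt exprn_gt0// normc_gt0.
Unshelve. all: by end_near. Qed.

End Landau.

(** * Cauchy's estimate and division on a zero-free circle *)

Section Division_bound.
Variable R : realType.
Implicit Types (f g c : nat -> Cplx R) (z a : R[i]) (p q : {poly R[i]}) (r rho : R).

(** [X^n - 1] splits over [R[i]] and is separable in characteristic 0. *)
Lemma primitive_root_exists n : (0 < n)%N -> exists x : R[i], n.-primitive_root x.
Proof.
move=> n_gt0; pose p : {poly R[i]} := 'X^n - 1.
have [s Dp] := closed_field_poly_normal p.
rewrite (monicP _) ?monicXnsubC// scale1r in Dp.
have sn1 : all n.-unity_root s by apply/allP => z; rewrite -root_prod_XsubC -Dp.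
have sz_s : (n <= size s)%N.
  by rewrite -ltnS -(size_prod_XsubC s id) -Dp size_XnsubC.
have [|z] := hasP (has_prim_root n_gt0 sn1 _ sz_s); last by exists z.
by rewrite -separable_prod_XsubC -Dp separable_Xn_sub_1// pnatr_eq0 -lt0n.
Qed.

Lemma normc_unity_root n (x : R[i]) : (0 < n)%N -> x ^+ n = 1 -> normc x = 1.
Proof.
move=> n0 /(congr1 (@normc R)); rewrite normcX Normc.normc1 => /eqP.
by rewrite pexpr_eq1 ?normc_ge0// => /eqP.
Qed.

Lemma sum_primitive_root n (x : R[i]) i : (0 < n)%N -> n.-primitive_root x ->
  \sum_(j < n) (x ^+ i) ^+ j = if (n %| i)%N then n%:R else 0.
Proof.
move=> n0 px; case: ifP => [|ni].
  rewrite (prim_order_dvd px) => /eqP ->.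
  by under eq_bigr do rewrite expr1n; rewrite sumr_const card_ord.
have xi1 : x ^+ i - 1 != 0 by rewrite subr_eq0 -(prim_order_dvd px) ni.
apply: (mulfI xi1); rewrite mulr0 -subrX1 -exprM mulnC exprM.
by rewrite (prim_expr_order px) expr1n subrr.
Qed.

(** An average over the [n]-th roots of unity replaces the contour integral; [n] exceeds both
    [size q] and [k], so that no other coefficient is aliased onto the [k]-th. *)
Lemma poly_cauchy_estimate q r (B : R) k : 0 <= r ->
  (forall z, normc z = r -> normc q.[z] <= B) -> normc q`_k * r ^+ k <= B.
Proof.
move=> r0 qB; pose n := (maxn (size q) k).+1.
have n0 : (0 < n)%N by [].
have [x px] := primitive_root_exists n0.
have x1 : normc x = 1 by apply: (normc_unity_root n0); exact: prim_expr_order px.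
have sq : (size q <= n)%N by rewrite ltnW// ltnS leq_maxl.
have kn : (k < n)%N by rewrite ltnS leq_maxr.
(* The exponent [j * (n - k)] stands for [- j * k], as [x ^+ n = 1]. *)
have E : \sum_(j < n) q.[r%:C * x ^+ j] * x ^+ (j * (n - k)) = n%:R * (q`_k * r%:C ^+ k).
  under eq_bigr => j _ do rewrite (horner_coef_wide _ sq) mulr_suml.
  rewrite exchange_big/=.
  rewrite (bigD1 (Ordinal kn))//= [X in _ + X]big1 ?addr0.
    transitivity (\sum_(j < n) q`_k * r%:C ^+ k).
      apply: eq_bigr => j _; rewrite exprMn -!mulrA -exprM -exprD -mulnDr.
      by rewrite subnKC 1?ltnW// mulnC exprM (prim_expr_order px) expr1n mulr1.
    by rewrite sumr_const card_ord mulr_natl.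
  move=> i /negP ik.
  transitivity (\sum_(j < n) q`_i * r%:C ^+ i * (x ^+ (i + (n - k))) ^+ j).
    apply: eq_bigr => j _; rewrite exprMn -!mulrA -!exprM -exprD mulnC.
    by rewrite [(j * _)%N]mulnC -mulnDl.
  rewrite -mulr_sumr sum_primitive_root//; case: ifP => [|]; last by rewrite mulr0.
  (* Since [i] and [k] are below [n], the number [i + (n - k)] lies strictly between 0 and [2n]; a
     multiple of [n] there is [n] itself, so [i = k]. *)
  move=> nik; exfalso; apply: ik; apply/eqP/val_inj => /=.
  have i_n := ltn_ord i.
  case/dvdnP: nik => -[|[|t]]; rewrite ?mul0n ?mul1n ?mulSn; move: kn i_n => /=; lia.
have : normc (n%:R * (q`_k * r%:C ^+ k)) <= n%:R * B.
  rewrite -E (le_trans (normc_sum _ _ _))// mulr_natl.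
  rewrite -[n in leRHS]card_ord -sumr_const ler_sum// => j _.
  rewrite Normc.normcM [X in _ * X]normcX x1 expr1n mulr1 qB//.
  by rewrite Normc.normcM normcX x1 expr1n mulr1 normc_real ger0_norm.
by rewrite !Normc.normcM normcX normc_real ger0_norm// normc_nat ler_pM2l// ltr0n.
Qed.

(** The extreme value theorem on the interval from [- r] to [r] is applied to each of the two half
    circles. *)
Lemma circle_min r rho f : 0 < r < rho -> cauchy_bound rho f ->
  (forall z : Cplx R, normc z = r -> ps_eval f z != 0) ->
  exists2 m : R, 0 < m & forall z : Cplx R, normc z = r -> m <= normc (ps_eval f z).
Proof.
move=> /andP[r0 rr] fb f0.
(* The sign [s = 1] or [s = -1] selects the upper or the lower half circle, parametrized by the real
   part. *)
pose Z (s x : R) : Cplx R := x +i* (s * Num.sqrt (r ^+ 2 - x ^+ 2)).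
have Zr s x : s ^+ 2 = 1 -> x \in `[- r, r] -> normc (Z s x) = r.
  move=> s1; rewrite in_itv/= -ler_norml => xr.
  rewrite /= exprMn s1 mul1r sqr_sqrtr ?subr_ge0 -?[x ^+ 2]real_normK ?num_real//.
    by rewrite addrC subrK sqrtr_sqr gtr0_norm.
  by rewrite lerXn2r// nnegrE ltW.
have half s : s ^+ 2 = 1 ->
    exists2 m : R, 0 < m & forall x, x \in `[- r, r] -> m <= normc (ps_eval f (Z s x)).
  move=> s1.
  have [||c cr cm] := @EVT_min R (fun x => normc (ps_eval f (Z s x))) (- r) r.
  - by rewrite ge0_cp// ltW.
  - apply: continuous_in_subspaceT => x; rewrite inE/= => xr.
    apply: normc_cvg_to.
    apply: (@cvg_comp _ _ _ (Z s) (ps_eval f) _ (nbhs (Z s x))).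
      apply: cvgC_ReIm => /=; first exact: cvg_id.
      apply: cvgM; first exact: cvg_cst.
      apply: (@cvg_comp _ _ _ (fun y : R => r ^+ 2 - y ^+ 2) (@Num.sqrt R) _
        (nbhs (r ^+ 2 - x ^+ 2))); last exact: sqrt_continuous.
      by apply: cvgB; [exact: cvg_cst|exact: exprn_continuous].
    by apply: (ps_eval_continuous fb); rewrite Zr.
  - exists (normc (ps_eval f (Z s c))); last exact: cm.
    by rewrite normc_gt0 f0// Zr.
have [m1 m10 h1] := half 1 (expr1n _ _).
have [m2 m20 h2] : exists2 m : R, 0 < m & forall x, x \in `[- r, r] -> m <= normc (ps_eval f (Z (-1) x)).
  by apply: half; rewrite sqrrN expr1n.
exists (Num.min m1 m2); first by rewrite lt_min m10.
move=> z zr.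
have xr : complex.Re z \in `[- r, r].
  by rewrite in_itv/= -ler_norml -zr Re_le_normc.
have E : Num.sqrt (r ^+ 2 - complex.Re z ^+ 2) = `|complex.Im z|.
  by rewrite -zr sqr_normcE addrC addKr sqrtr_sqr.
have zE : z = complex.Re z +i* complex.Im z by case: (z).
have [i0|i0] := lerP 0 (complex.Im z).
  rewrite ge_min; apply/orP; left; have := h1 _ xr; rewrite /Z E (ger0_norm i0) mul1r.
  rewrite -zE; exact.
rewrite ge_min; apply/orP; right; have := h2 _ xr; rewrite /Z E (ltr0_norm i0) mulN1r opprK.
rewrite -zE; exact.
Qed.

(** On a zero-free circle of radius [r1] between [r] and [rho], [q] is the quotient of a function
    bounded by a multiple of [B] by one bounded below by [m]. The constant does not depend on [q],
    so it serves all differences of successive approximants at once. *)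
Lemma division_bound r rho f : 0 < r < rho -> cauchy_bound rho f -> f 0%N != 0 ->
  exists2 K : R, 0 < K & forall q (B : R),
    (forall k, normc (poly_mul q f k) * rho ^+ k <= B) ->
    forall k, normc q`_k * r ^+ k <= K * B.
Proof.
move=> /andP[r0 rr] fb f0.
have h1 : 0 < r < (r + rho) / 2 by rewrite r0/=; lra.
have h2 : (r + rho) / 2 < rho by lra.
have [r1 [/andP[r01 r1r] f1]] := zero_free_circle h1 h2 fb f0.
have r10 : 0 < r1 by lra.
have [|m m0 mf] := circle_min _ fb f1; first by rewrite r10; lra.
have t1 : 0 < 1 - r1 / rho by rewrite subr_gt0 ltr_pdivrMr ?mul1r; lra.
exists (m^-1 / (1 - r1 / rho)); first by rewrite divr_gt0// invr_gt0.
move=> q B qB k; apply: le_trans (_ : normc q`_k * r1 ^+ k <= _).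
  by rewrite ler_wpM2l ?normc_ge0// lerXn2r ?nnegrE; lra.
apply: poly_cauchy_estimate; first lra.
move=> z zr; have zrho : normc z < rho by rewrite zr; lra.
have := ps_eval_norm zrho qB; rewrite (ps_eval_poly_mul _ fb zrho) Normc.normcM zr.
have := mf z zr; set a := normc q.[z]; set b := normc (ps_eval f z) => mb ab.
rewrite -mulrA ler_pdivlMl// [leRHS]mulrC; apply: le_trans ab.
by rewrite mulrC ler_wpM2l// normc_ge0.
Qed.

End Division_bound.

(** * The weighted norm as a real limit, and Pythagoras' theorem *)

Section Weighted_norm.
Variables (R : realType) (w : nat -> R).
Hypothesis w_gt0 : forall n, 0 < w n.
Implicit Types (f g h u x y : nat -> Cplx R) (p q : {poly R[i]}).

(** Real-valued counterpart of the square of [H2norm]. The limit [sqnorm] is meaningful only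
    together with [sq_summable]. *)
Definition sqseries g := series (fun n => normc (g n) ^+ 2 * w n).
Definition sq_summable g := cvgn (sqseries g).
Definition sqnorm g : R := limn (sqseries g).

Lemma sqterm_ge0 g n : 0 <= normc (g n) ^+ 2 * w n.
Proof. by rewrite mulr_ge0 ?sqr_ge0// ltW. Qed.

Lemma sqseries_nd g : nondecreasing_seq (sqseries g).
Proof. by apply: nondecreasing_series => n _ _; exact: sqterm_ge0. Qed.

Lemma sqnorm_cvg g : sq_summable g -> sqseries g @ \oo --> sqnorm g.
Proof. by []. Qed.

Lemma cvg_sqnorm g (S : R) : sqseries g @ \oo --> S -> sq_summable g /\ sqnorm g = S.
Proof. by move=> gS; split; [apply: cvgP gS|exact: cvg_lim gS]. Qed.

Lemma sqseries_le g n : sq_summable g -> sqseries g n <= sqnorm g.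
Proof. by move=> gs; apply: nondecreasing_cvgn_le => //; exact: sqseries_nd. Qed.

Lemma sqnorm_ge0 g : sq_summable g -> 0 <= sqnorm g.
Proof. by move/(sqseries_le 0%N); rewrite /sqseries/series/= big_geq. Qed.

Lemma sqterm_le g n : sq_summable g -> normc (g n) ^+ 2 * w n <= sqnorm g.
Proof.
move=> gs; apply: le_trans (sqseries_le n.+1 gs).
by rewrite /sqseries/series/= big_nat_recr//= lerDr sumr_ge0// => i _; exact: sqterm_ge0.
Qed.

Lemma sq_summable_bounded g (C : R) : (forall n, sqseries g n <= C) ->
  sq_summable g /\ sqnorm g <= C.
Proof.
move=> gC; have gs : sq_summable g.
  apply: nondecreasing_is_cvgn; first exact: sqseries_nd.
  by exists C => _ [n _ <-].
by split => //; apply: limr_le => //; exact: nearW.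
Qed.

Lemma H2norm_sqnorm g : sq_summable g -> H2norm w g = (Num.sqrt (sqnorm g))%:E.
Proof.
move=> gs; rewrite /H2norm.
suff -> : (\sum_(0 <= n <oo) (normc (g n) ^+ 2 * w n)%:E = (sqnorm g)%:E)%E by [].
rewrite -(EFin_lim gs); congr (limn _); apply/funext => n /=.
by rewrite sumEFin.
Qed.

Lemma sq_summable_H2norm g : (H2norm w g < +oo)%E -> sq_summable g.
Proof.
rewrite /H2norm; set S := (X in sqrte X) => S_fin.
have S0 : (0 <= S)%E.
  by apply: nneseries_ge0 => n _ _; rewrite lee_fin sqterm_ge0.
have : (S \is a fin_num)%E.
  rewrite -sqrte_fin_num// ge0_fin_numE// sqrte_ge0//.
move=> /fineK SE.
apply: (proj1 (@sq_summable_bounded g (fine S) _)) => n.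
rewrite -lee_fin SE -sumEFin; apply: nneseries_lim_ge => k _ _.
by rewrite lee_fin sqterm_ge0.
Qed.

Lemma ler_H2norm g h : sq_summable g -> sq_summable h ->
  (H2norm w g <= H2norm w h)%E = (sqnorm g <= sqnorm h).
Proof.
move=> gs hs; rewrite !H2norm_sqnorm// lee_fin ler_sqrt// sqnorm_ge0//.
Qed.

Definition ps_line x u (t : R) : nat -> Cplx R := fun n => x n + t%:C * u n.

(** Stewart's identity: it describes the squared norm along a line without an inner product. *)
Lemma normc_line (a b : R[i]) (t : R) : normc (a + t%:C * b) ^+ 2 =
  (1 - t) * normc a ^+ 2 + t * normc (a + b) ^+ 2 - t * (1 - t) * normc b ^+ 2.
Proof. by rewrite !sqr_normcE; case: a b => [a1 a2] [b1 b2] /=; ring. Qed.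

Lemma ps_line1 x u n : ps_line x u 1 n = x n + u n.
Proof. by rewrite /ps_line mul1r. Qed.

Lemma sqr_normcD_le (a b : R[i]) :
  normc (a + b) ^+ 2 <= 2 * normc a ^+ 2 + 2 * normc b ^+ 2.
Proof.
rewrite !sqr_normcE; case: a b => [a1 a2] [b1 b2] /=.
have := sqr_ge0 (a1 - b1); have := sqr_ge0 (a2 - b2); nra.
Qed.

Lemma sq_summable_line1 x u : sq_summable x -> sq_summable u -> sq_summable (ps_line x u 1).
Proof.
move=> xs us; apply: (proj1 (@sq_summable_bounded _ (2 * sqnorm x + 2 * sqnorm u) _)) => n.
apply: le_trans (lerD (ler_wpM2l _ (sqseries_le n xs)) (ler_wpM2l _ (sqseries_le n us))) => //.
rewrite /sqseries/series/= !mulr_sumr -big_split/=; apply: ler_sum => k _.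
rewrite mulrA [X in _ + X]mulrA -mulrDl; apply: ler_wpM2r; first exact: ltW.
by rewrite ps_line1; exact: sqr_normcD_le.
Qed.

Lemma sqnorm_line x u t : sq_summable x -> sq_summable u ->
  sq_summable (ps_line x u t) /\ sqnorm (ps_line x u t) =
  (1 - t) * sqnorm x + t * sqnorm (ps_line x u 1) - t * (1 - t) * sqnorm u.
Proof.
move=> xs us; have xus := sq_summable_line1 xs us; apply: cvg_sqnorm.
suff -> : sqseries (ps_line x u t) = fun n => (1 - t) * sqseries x n +
    t * sqseries (ps_line x u 1) n - t * (1 - t) * sqseries u n.
  apply: cvgB; [apply: cvgD|]; apply: cvgM; (exact: cvg_cst || exact: sqnorm_cvg).
apply/funext => n; rewrite /sqseries/series/= !mulr_sumr -big_split -sumrB/=.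
apply: eq_bigr => k _; rewrite normc_line ps_line1; ring.
Qed.

(** At [t = - b / (c + 1)] the quadratic equals [- (b / (c + 1))^2]; the shift by 1 keeps the
    denominator positive when [c = 0]. *)
Lemma quadratic_ge0_linear0 (b c : R) : 0 <= c -> (forall t, 0 <= t * b + t ^+ 2 * c) -> b = 0.
Proof.
move=> c0 /(_ (- b / (c + 1))).
have c1 : 0 < c + 1 by lra.
have -> : - b / (c + 1) * b + (- b / (c + 1)) ^+ 2 * c = - (b / (c + 1)) ^+ 2.
  by field; rewrite gt_eqF.
rewrite oppr_ge0 => h; have := sqr_ge0 (b / (c + 1)).
move=> /(conj h)/andP/le_anti/eqP; rewrite sqrf_eq0 mulf_eq0 invr_eq0 (gt_eqF c1) orbF.
by move/eqP.
Qed.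

(** Along the line the squared norm is a quadratic in [t]; minimality at [t = 0] kills its linear
    coefficient. Real [t] suffice, since only the real part of the inner product enters. *)
Lemma sqnorm_pythagoras x u : sq_summable x -> sq_summable u ->
  (forall t, sqnorm x <= sqnorm (ps_line x u t)) ->
  sqnorm (ps_line x u 1) = sqnorm x + sqnorm u.
Proof.
move=> xs us xmin.
have : sqnorm (ps_line x u 1) - sqnorm x - sqnorm u = 0.
  apply: (@quadratic_ge0_linear0 _ (sqnorm u)); first exact: sqnorm_ge0.
  by move=> t; have := xmin t; rewrite (proj2 (sqnorm_line t xs us)); lra.
by lra.
Qed.

Lemma poly_mulDl p q g n : poly_mul (p + q) g n = poly_mul p g n + poly_mul q g n.
Proof. by rewrite -big_split; apply: eq_bigr => i _; rewrite coefD mulrDl. Qed.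

Lemma poly_mulZl (c : R[i]) q g n : poly_mul (c *: q) g n = c * poly_mul q g n.
Proof. by rewrite mulr_sumr; apply: eq_bigr => i _; rewrite coefZ mulrA. Qed.

Lemma sq_summable_sub x y : sq_summable x -> sq_summable y ->
  sq_summable (ps_sub x y) /\ sqnorm (ps_sub x y) <= 2 * sqnorm x + 2 * sqnorm y.
Proof.
move=> xs ys; apply: sq_summable_bounded => n.
apply: le_trans (lerD (ler_wpM2l _ (sqseries_le n xs)) (ler_wpM2l _ (sqseries_le n ys))) => //.
rewrite /sqseries/series/= !mulr_sumr -big_split/=; apply: ler_sum => k _.
rewrite mulrA [X in _ + X]mulrA -mulrDl; apply: ler_wpM2r; first exact: ltW.
by rewrite -[X in _ <= _ + 2 * X ^+ 2]normc_opp; exact: sqr_normcD_le.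
Qed.

Lemma sq_summable_scale (c : R[i]) x : sq_summable x ->
  sq_summable (fun n => c * x n) /\ sqnorm (fun n => c * x n : Cplx R) = normc c ^+ 2 * sqnorm x.
Proof.
move=> xs; apply: cvg_sqnorm.
suff -> : sqseries (fun n => c * x n) = fun n => normc c ^+ 2 * sqseries x n.
  by apply: cvgM; [exact: cvg_cst|exact: sqnorm_cvg].
apply/funext => n; rewrite /sqseries/series/= mulr_sumr; apply: eq_bigr => k _.
by rewrite Normc.normcM exprMn mulrA.
Qed.

Lemma poly_mulXn n g k :
  poly_mul 'X^n g k = if (n <= k)%N then g (k - n)%N else 0.
Proof.
rewrite /poly_mul; case: ifP => nk.
  rewrite -ltnS in nk; rewrite (bigD1 (Ordinal nk))//= coefXn eqxx mul1r big1 ?addr0// => i.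
  by rewrite -val_eqE/= coefXn => /negbTE ->; rewrite mul0r.
rewrite big1// => i _; rewrite coefXn; case: eqP => [E|_]; last by rewrite mul0r.
by move: (ltn_ord i); rewrite ltnS E nk.
Qed.

Lemma sq_summable_shift n g (L : R) : (forall k, w (n + k)%N <= L * w k) -> sq_summable g ->
  sq_summable (poly_mul 'X^n g) /\ sqnorm (poly_mul 'X^n g) <= L * sqnorm g.
Proof.
move=> wL gs; have L0 : 0 <= L.
  have := wL 0%N; have h1 := w_gt0 (n + 0)%N; have h2 := w_gt0 0%N.
  by move=> h; rewrite -(pmulr_lge0 _ h2) (le_trans (ltW h1)).
apply: sq_summable_bounded => K; apply: le_trans (ler_wpM2l L0 (sqseries_le K gs)).
apply: le_trans (_ : sqseries (poly_mul 'X^n g) (n + K)%N <= _).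
  by apply: sqseries_nd; rewrite leq_addl.
rewrite /sqseries/series/= !big_mkord big_split_ord/= big1 ?add0r; last first.
  move=> i _; rewrite poly_mulXn leqNgt ltn_ord/=.
  by rewrite expr0n addr0 sqrtr0 expr0n mul0r.
rewrite mulr_sumr; apply: ler_sum => i _; rewrite poly_mulXn leq_addr addKn.
by rewrite mulrCA ler_wpM2l ?sqr_ge0.
Qed.

End Weighted_norm.

(** * Subexponential behaviour of the weights *)

Section Weights.
Variables (R : realType) (w : nat -> R).
Hypothesis w_gt0 : forall n, 0 < w n.
Hypothesis w_ratio : (w n / w n.+1) @[n --> \oo] --> (1 : R).

(** From some [N] on, a step multiplies the weight by at most [1 + e]; each of the [N] earlier steps
    costs at most a factor [L], whatever the starting index [k]. *)
Lemma weight_growth (e : R) : 0 < e ->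
  exists2 C : R, 0 < C & forall n k, w (n + k)%N <= C * (1 + e) ^+ n * w k.
Proof.
move=> e0; have e1 : 0 < 1 + e by lra.
have : \forall n \near \oo, (1 + e)^-1 < w n / w n.+1.
  by apply: (cvgr_gt 1) => //; rewrite invf_lt1; lra.
case=> N _ wN.
pose L : R := 1 + \sum_(i < N) w i.+1 / w i.
have L1 : 1 <= L by rewrite lerDl sumr_ge0// => i _; rewrite divr_ge0// ltW.
have L0 : 0 < L by lra.
(* Dividing [w m] by [L ^+ minn m N] charges [L] once for each early step, so that every step grows
   by at most [1 + e]. *)
have step m : w m.+1 * L ^+ minn m N <= (1 + e) * L ^+ minn m.+1 N * w m.
  have [Nm|mN] := leqP N m.
    rewrite (minn_idPr (leqW Nm)) mulrAC ler_wpM2r ?exprn_ge0 ?(ltW L0)//.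
    by have /= := wN m Nm; rewrite ltr_pdivlMr// mulrC ltr_pdivrMr// mulrC => /ltW.
  rewrite (minn_idPl mN) exprS mulrA mulrAC.
  rewrite ler_wpM2r ?exprn_ge0 ?(ltW L0)//.
  have wL : w m.+1 <= L * w m.
    rewrite -ler_pdivrMr// /L (bigD1 (Ordinal mN))//= addrCA lerDl addr_ge0//.
    by rewrite sumr_ge0// => i _; rewrite divr_ge0// ltW.
  apply: le_trans wL _; rewrite -mulrA ler_peMl ?mulr_ge0 ?(ltW L0) ?(ltW (w_gt0 _))//; lra.
have ind n k : w (n + k)%N * L ^+ minn k N <= (1 + e) ^+ n * L ^+ minn (n + k) N * w k.
  elim: n => [|n IH]; first by rewrite mul1r mulrC.
  have Lp : 0 < L ^+ minn (n + k) N by rewrite exprn_gt0.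
  rewrite -(ler_pM2r Lp) addSn mulrAC.
  apply: le_trans (_ : (1 + e) * L ^+ minn (n + k).+1 N * w (n + k)%N * L ^+ minn k N <= _).
    by rewrite ler_wpM2r ?exprn_ge0 ?(ltW L0)// step.
  rewrite -mulrA; apply: le_trans (ler_wpM2l _ IH) _.
    by rewrite mulr_ge0 ?exprn_ge0// ltW.
  by rewrite exprS le_eqVlt; apply/orP; left; apply/eqP; ring.
exists (L ^+ N); first by rewrite exprn_gt0.
move=> n k; apply: le_trans (_ : w (n + k)%N * L ^+ minn k N <= _).
  by rewrite ler_peMr ?(ltW (w_gt0 _))// exprn_ege1.
apply: le_trans (ind n k) _; rewrite ler_wpM2r ?(ltW (w_gt0 _))//.
rewrite mulrC ler_wpM2r ?exprn_ge0 ?(ltW e1)// ler_weXn2l//.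
exact: geq_minr.
Qed.

(** [s^k / w k] is eventually nonincreasing, because [w k / w (k + 1)] is eventually below [1 / s];
    the sum of its first values bounds it. *)
Lemma weight_lower (s : R) : 0 < s < 1 -> exists2 C : R, 0 < C & forall k, s ^+ k <= C * w k.
Proof.
move=> /andP[s0 s1].
have : \forall n \near \oo, w n / w n.+1 < s^-1.
  by apply: (cvgr_lt 1) => //; rewrite invf_gt1.
case=> N _ wN; pose u k := s ^+ k / w k.
have u0 k : 0 < u k by rewrite divr_gt0// exprn_gt0.
have u_ni k : (N <= k)%N -> u k.+1 <= u k.
  move=> Nk; rewrite /u exprS ler_pdivrMr// mulrAC ler_pdivlMr//.
  rewrite mulrAC [leRHS]mulrC ler_wpM2r ?exprn_ge0 ?(ltW s0)//.
  by have /= := wN k Nk; rewrite ltr_pdivrMr// ltr_pdivlMl// => /ltW.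
exists (\sum_(i < N.+1) u i).
  by rewrite big_ord_recr/= ltr_wpDl// sumr_ge0// => i _; rewrite ltW.
have uN k : u k <= \sum_(i < N.+1) u i.
  have base j : (j < N.+1)%N -> u j <= \sum_(i < N.+1) u i.
    by move=> jN; rewrite (bigD1 (Ordinal jN))//= lerDl sumr_ge0// => i _; rewrite ltW.
  have [kN|Nk] := ltnP k N.+1; first exact: base.
  rewrite -(subnK Nk); elim: (k - N.+1)%N => [|m IH]; first by rewrite add0n (le_trans (u_ni N _))// base.
  by rewrite addSn (le_trans (u_ni _ _))// ltnW// ltn_addl.
by move=> k; have := uN k; rewrite {1}/u ler_pdivrMr.
Qed.

End Weights.

(** * Coefficient bounds and orthogonality in the weighted space *)

Section Hardy_sequences.
Variables (R : realType) (w : nat -> R).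
Hypothesis w_gt0 : forall n, 0 < w n.
Implicit Types (f g h u x y : nat -> Cplx R) (p q : {poly R[i]}).

(** The terms of the series at the point [rho] tend to 0, hence are bounded. *)
Lemma analytic_cauchy_bound f rho : 0 < rho < 1 -> analytic_in_unit_disk f ->
  cauchy_bound rho f.
Proof.
move=> /andP[r0 r1] /(_ rho%:C).
have rd : disk 1 (rho%:C : Cplx R) by change (is_true (normc rho%:C < 1)); rewrite normc_real gtr0_norm.
move=> /(_ rd)/cvg_series_cvg_0/cvgC_lt/(_ 1 ltr01)[N _ uN].
pose u k := normc (f k) * rho ^+ k.
have u0 k : 0 <= u k by rewrite mulr_ge0 ?normc_ge0 ?exprn_ge0// ltW.
exists (1 + \sum_(i < N) u i) => n.
have [nN|Nn] := ltnP n N.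
  by rewrite -/(u n) (bigD1 (Ordinal nN))//= addrCA lerDl addr_ge0// sumr_ge0.
apply: (@le_trans _ _ 1); last by rewrite lerDl sumr_ge0.
have : normc (0 - f n * rho%:C ^+ n) < 1 := uN n Nn; rewrite sub0r normc_opp Normc.normcM normcX normc_real.
by rewrite gtr0_norm// => /ltW.
Qed.

Lemma analytic_of_cauchy_bound f :
  (forall rho, 0 < rho < 1 -> cauchy_bound rho f) -> analytic_in_unit_disk f.
Proof.
move=> fb z z1; have z0 := normc_ge0 z; rewrite /disk/= in z1.
have r : 0 < (normc z + 1) / 2 < 1 by apply/andP; split; lra.
have zr : normc z < (normc z + 1) / 2 by lra.
by apply/cvg_ex; exists (ps_eval f z); exact: ps_eval_cvg (fb _ r) zr.
Qed.

Lemma eq_sqnorm x y : (forall n, normc (x n) = normc (y n)) -> sq_summable w x ->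
  sq_summable w y /\ sqnorm w x = sqnorm w y.
Proof.
move=> xy xs; have -> : sqnorm w x = sqnorm w y.
  by congr (limn _); apply/funext => n; apply: eq_bigr => k _; rewrite xy.
split=> //; move: xs; rewrite /sq_summable; suff -> : sqseries w x = sqseries w y by [].
by apply/funext => n; apply: eq_bigr => k _; rewrite xy.
Qed.

Lemma sqnormB_sym x y : sq_summable w x -> sq_summable w y ->
  sqnorm w (ps_sub x y) = sqnorm w (ps_sub y x).
Proof.
move=> xs ys; have [s _] := sq_summable_sub w_gt0 xs ys.
by apply: (proj2 (eq_sqnorm _ s)) => n; exact: normc_distC.
Qed.

Lemma Re_conj_mul (a b : R[i]) : complex.Re (a * b^*) =
  (normc (a + b) ^+ 2 - normc a ^+ 2 - normc b ^+ 2) / 2.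
Proof. by rewrite !sqr_normcE; case: a b => [a1 a2] [b1 b2] /=; field. Qed.

Lemma Im_conj_mul (a b : R[i]) : complex.Im (a * b^*) =
  (normc (a + 'i * b) ^+ 2 - normc a ^+ 2 - normc ('i * b) ^+ 2) / 2.
Proof. by rewrite !sqr_normcE; case: a b => [a1 a2] [b1 b2] /=; field. Qed.

Lemma cvg_cross x u : sq_summable w x -> sq_summable w u ->
  series (fun n => (normc (x n + u n) ^+ 2 - normc (x n) ^+ 2 - normc (u n) ^+ 2) / 2 * w n)
    @ \oo --> (sqnorm w (ps_line x u 1) - sqnorm w x - sqnorm w u) / 2.
Proof.
move=> xs us; have xus := sq_summable_line1 w_gt0 xs us.
suff -> : series (fun n =>
    (normc (x n + u n) ^+ 2 - normc (x n) ^+ 2 - normc (u n) ^+ 2) / 2 * w n) =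
  fun n => (sqseries w (ps_line x u 1) n - sqseries w x n - sqseries w u n) * 2^-1.
  by apply: cvgM; [apply: cvgB; [apply: cvgB|]|exact: cvg_cst]; exact: sqnorm_cvg.
apply/funext => n; rewrite /sqseries/series/= -!sumrB mulr_suml.
apply: eq_bigr => k _; rewrite ps_line1; ring.
Qed.

(** [H2inner] is a [limn], so its vanishing is informative only once the series is known to
    converge. Polarization of both parts proves this and identifies the limit; its real part gives
    the claim. *)
Lemma orthogonal_pythagoras x u : sq_summable w x -> sq_summable w u ->
  H2inner w x u = 0 -> sqnorm w (ps_line x u 1) = sqnorm w x + sqnorm w u.
Proof.
move=> xs us; have [ius _] := sq_summable_scale 'i us.
have ReM (a : R[i]) (b : R) : complex.Re (a * b%:C) = complex.Re a * b.
  by case: a => a1 a2 /=; ring.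
have ImM (a : R[i]) (b : R) : complex.Im (a * b%:C) = complex.Im a * b.
  by case: a => a1 a2 /=; ring.
have h : series (fun n => x n * (u n)^* * (w n)%:C : Cplx R) @ \oo -->
    ((sqnorm w (ps_line x u 1) - sqnorm w x - sqnorm w u) / 2 +i*
     ((sqnorm w (ps_line x (fun n => 'i * u n) 1) - sqnorm w x
       - sqnorm w (fun n => 'i * u n)) / 2) : Cplx R).
  apply: cvgC_ReIm.
    apply: cvg_trans (cvg_cross xs us); apply: near_eq_cvg; near=> n.
    rewrite /series/= raddf_sum; apply: eq_bigr => k _.
    by rewrite -Re_conj_mul -ReM.
  apply: cvg_trans (cvg_cross xs ius); apply: near_eq_cvg; near=> n.
  rewrite /series/= raddf_sum; apply: eq_bigr => k _.
  by rewrite -Im_conj_mul -ImM.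
rewrite /H2inner (cvgC_lim h) => /(congr1 (@complex.Re R)) /= E; lra.
Unshelve. all: by end_near. Qed.

End Hardy_sequences.

(** * Norm identities and leading coefficients of optimal approximants *)

Section Optimal_approximants.
Variables (R : realType) (w : nat -> R) (f : nat -> Cplx R) (p : nat -> {poly R[i]}).
Hypothesis w_gt0 : forall n, 0 < w n.
Hypothesis w0 : w 0%N = 1.
Hypothesis w_ratio : (w n / w n.+1) @[n --> \oo] --> (1 : R).
Hypothesis fH2 : H2 w f.
Hypothesis f0 : f 0%N != 0.
Hypothesis p_opt : forall n, is_optimal_approximant w f n (p n).
Implicit Types (q : {poly R[i]}).

Let err q := ps_sub (poly_mul q f) (@ps_one R).

Lemma H2_sq_summable g : H2 w g -> sq_summable w g.
Proof. by move=> [_]; exact: sq_summable_H2norm. Qed.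

Lemma sq_summable_one : sq_summable w (@ps_one R) /\ sqnorm w (@ps_one R) = 1.
Proof.
apply: cvg_sqnorm; apply: cvg_near_cst; near=> n.
have n0 : (0 < n)%N by near: n; exists 1%N.
rewrite /sqseries/series/= -(prednK n0) big_nat_recl//= big1_seq ?addr0.
  by rewrite w0 expr1n expr0n addr0 sqrtr1 expr1n mulr1.
by move=> i _; rewrite !expr0n addr0 sqrtr0 expr0n mul0r.
Unshelve. all: by end_near. Qed.

Lemma sq_summable_poly_mul q : sq_summable w (poly_mul q f).
Proof.
have fs := H2_sq_summable fH2.
rewrite -[q]coefK poly_def.
elim: (size q) => [|n IH].
  rewrite big_ord0; apply: (proj1 (@sq_summable_bounded _ _ w_gt0 _ 0 _)) => n.
  rewrite /sqseries/series/= big1// => i _; rewrite /poly_mul big1.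
    by rewrite Normc.normc0 expr0n mul0r.
  by move=> j _; rewrite coef0 mul0r.
rewrite big_ord_recr/=.
have [C C0 wC] := weight_growth w_gt0 w_ratio ltr01.
have [xs _] := sq_summable_shift w_gt0 (wC n) fs.
have [ys _] := sq_summable_scale (q`_n) xs.
have := sq_summable_line1 w_gt0 IH ys.
suff -> : poly_mul (\sum_(i < n) q`_i *: 'X^i + q`_n *: 'X^n) f =
  ps_line (poly_mul (\sum_(i < n) q`_i *: 'X^i) f) (fun k => q`_n * poly_mul 'X^n f k) 1 by [].
by apply/funext => k; rewrite ps_line1 poly_mulDl poly_mulZl.
Qed.

Arguments sq_summable_poly_mul q : clear implicits.

Lemma sq_summable_err q : sq_summable w (err q).
Proof.
have [h _] := sq_summable_sub w_gt0 (sq_summable_poly_mul q) (proj1 sq_summable_one).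
exact: h.
Qed.
Arguments sq_summable_err q : clear implicits.

Lemma poly_mulBl (q1 q2 : {poly R[i]}) n :
  poly_mul (q1 - q2) f n = poly_mul q1 f n - poly_mul q2 f n.
Proof. by rewrite -scaleN1r poly_mulDl poly_mulZl mulN1r. Qed.

(** [p n + t (q - p n)] is an admissible competitor for every real [t], so the error is minimal
    along this line. *)
Lemma optimal_pythagoras n q : (size q <= n.+1)%N ->
  sqnorm w (err q) = sqnorm w (err (p n)) + sqnorm w (poly_mul (q - p n) f).
Proof.
move=> sq; have [sp pmin] := p_opt n.
have L t : ps_line (err (p n)) (poly_mul (q - p n) f) t = err (p n + t%:C *: (q - p n)).
  apply/funext => k; rewrite /ps_line /err /ps_sub [in RHS]poly_mulDl poly_mulZl.
  by rewrite addrAC.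
have <- : ps_line (err (p n)) (poly_mul (q - p n) f) 1 = err q.
  by rewrite L scale1r addrC subrK.
apply: sqnorm_pythagoras => //; [exact: sq_summable_err|exact: sq_summable_poly_mul|].
move=> t; rewrite L -ler_H2norm//; [|exact: sq_summable_err|exact: sq_summable_err].
apply: pmin; rewrite (leq_trans (size_polyD _ _))// geq_max sp/=.
rewrite (leq_trans (size_scale_leq _ _))// (leq_trans (size_polyD _ _))//.
by rewrite geq_max sq size_polyN.
Qed.

Lemma sqnorm_err0 : sqnorm w (err 0) = 1.
Proof.
have [s1 <-] := sq_summable_one; apply/esym/(proj2 (eq_sqnorm _ s1)) => n.
rewrite /err /ps_sub (_ : poly_mul 0 f n = 0) ?sub0r ?normc_opp//.
by rewrite /poly_mul big1// => i _; rewrite coef0 mul0r.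
Qed.

(** Pythagoras against the competitor 0, whose error is 1. *)
Lemma sqnorm_optimal_le1 n : sqnorm w (poly_mul (p n) f) <= 1.
Proof.
have := @optimal_pythagoras n 0; rewrite size_poly0 sqnorm_err0 => /(_ isT).
have -> : sqnorm w (poly_mul (0 - p n) f) = sqnorm w (poly_mul (p n) f).
  apply: (proj2 (eq_sqnorm _ (sq_summable_poly_mul (0 - p n)))) => k.
  by rewrite sub0r -scaleN1r poly_mulZl mulN1r normc_opp.
have := sqnorm_ge0 w_gt0 (sq_summable_err (p n)); lra.
Qed.

(** If [p n] were 0, the constant [q = 1 / f 0] would satisfy [||q f - 1||^2 = 1 + ||q f||^2]; yet
    subtracting 1 merely deletes the constant coefficient of [q f]. *)
Lemma optimal_neq0 n : p n != 0.
Proof.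
apply/eqP => pn0; pose q : {poly R[i]} := (f 0%N)^-1%:P.
have := @optimal_pythagoras n q; rewrite pn0 subr0 sqnorm_err0.
move=> /(_ (leq_trans (size_polyC_leq1 _) (ltn0Sn n))) E.
suff : sqnorm w (err q) <= sqnorm w (poly_mul q f) by lra.
apply: (proj2 (sq_summable_bounded w_gt0 _)) => N.
apply: le_trans (sqseries_le w_gt0 N (sq_summable_poly_mul q)).
apply: ler_sum => k _; apply: ler_wpM2r; first exact: ltW.
case: k => [|k]; last first.
  rewrite (_ : err q k.+1 = poly_mul q f k.+1); first exact: lexx.
  exact: (subr0 (poly_mul q f k.+1)).
have -> : err q 0%N = 0 by rewrite /err /ps_sub poly_mul0 coefC eqxx mulVf// subrr.
have -> : normc (0 : Cplx R) = 0 by exact: Normc.normc0.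
by rewrite expr0n sqr_ge0.
Qed.

(** By Pythagoras the left side is the drop of the squared error from [p n] to [p (n + 1)]. As [p n]
    is at least as good as [q], it is at most the drop from [q] to [p (n + 1)], which is the right
    side. *)
Lemma sqnorm_optimal_step n :
  sqnorm w (poly_mul (p n.+1 - p n) f) <=
  normc (p n.+1)`_n.+1 ^+ 2 * sqnorm w (poly_mul 'X^(n.+1) f).
Proof.
have [sp _] := p_opt n; have [sp1 _] := p_opt n.+1.
have E1 := optimal_pythagoras (leqW sp).
(* [p (n + 1)] without its top term: a competitor of degree at most [n]. *)
pose q := p n.+1 - (p n.+1)`_n.+1 *: 'X^(n.+1).
have sq : (size q <= n.+1)%N.
  apply/leq_sizeP => j nj; rewrite coefB coefZ coefXn.
  have [->|jn] := eqVneq j n.+1; first by rewrite mulr1 subrr.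
  rewrite mulr0 subr0 nth_default// (leq_trans sp1)// ltn_neqAle nj andbT.
  by rewrite eq_sym.
have E2 := optimal_pythagoras sq.
have E3 := optimal_pythagoras (leqW sq).
have -> : sqnorm w (poly_mul (p n.+1 - p n) f) = sqnorm w (poly_mul (p n - p n.+1) f).
  apply: (proj2 (eq_sqnorm _ (sq_summable_poly_mul _))) => k.
  by rewrite !poly_mulBl normc_distC.
have <- : sqnorm w (poly_mul (q - p n.+1) f) =
    normc (p n.+1)`_n.+1 ^+ 2 * sqnorm w (poly_mul 'X^(n.+1) f).
  have [ss <-] := sq_summable_scale ((p n.+1)`_n.+1) (sq_summable_poly_mul 'X^(n.+1)).
  apply/esym/(proj2 (eq_sqnorm _ ss)) => k.
  by rewrite /q addrAC subrr sub0r -scaleNr poly_mulZl mulNr normc_opp.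
have := sqnorm_ge0 w_gt0 (sq_summable_poly_mul (q - p n)); lra.
Qed.

(** The lower bound on the weights, at [s = r^2]. *)
Lemma l2_bound_sqnorm r : 0 < r < 1 -> exists2 C : R, 0 < C &
  forall g, sq_summable w g -> l2_bound r g (C * sqnorm w g).
Proof.
move=> /andP[r0 r1]; have r2 : 0 < r ^+ 2 < 1 by rewrite exprn_gt0// exprn_ilt1// ltW.
have [C C0 wC] := weight_lower w_gt0 w_ratio r2; exists C => // g gs K.
apply: le_trans (ler_wpM2l (ltW C0) (sqseries_le w_gt0 K gs)).
rewrite /sqseries/series/= big_mkord mulr_sumr; apply: ler_sum => k _.
by rewrite exprMn -exprM mulnC exprM mulrCA ler_wpM2l ?sqr_ge0.
Qed.

(** Landau's inequality is applied to the zeros of [p n] and to [f] scaled by the leading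
    coefficient, with [||p_n f|| <= 1]. *)
Lemma optimal_lead_bound (eps r : R) : 0 < eps -> 0 < r < 1 ->
  exists2 C : R, 0 < C & forall n,
    normc (p n)`_n * r ^+ n * (1 + eps) ^+ (n - count_zeros (1 + eps) (p n)) <= C.
Proof.
move=> eps0 r01; have /andP[r0 r1] := r01.
have [C C0 l2C] := l2_bound_sqnorm r01.
have fn0 : 0 < normc (f 0%N) by rewrite normc_gt0.
exists (Num.sqrt C / normc (f 0%N)); first by rewrite divr_gt0// sqrtr_gt0.
move=> n; have [sp _] := p_opt n.
have C'0 : 0 <= Num.sqrt C / normc (f 0%N) by rewrite divr_ge0 ?sqrtr_ge0// ltW.
(* If the coefficient of degree [n] vanishes, the bound is trivial; otherwise [p n] has exactly [n]
   zeros. *)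
have [->|pn0] := eqVneq (p n)`_n 0; first by rewrite Normc.normc0 !mul0r.
have szp : size (p n) = n.+1.
  apply/eqP; rewrite eqn_leq sp ltnNge; apply/negP => /(nth_default 0) pn.
  by rewrite pn eqxx in pn0.
rewrite /count_zeros; case: closed_field_poly_normal => s /= ps.
have lc : lead_coef (p n) = (p n)`_n by rewrite lead_coefE szp.
have ss : size s = n.
  have := congr1 (fun P : {poly R[i]} => size P) ps; rewrite lc szp size_scale//.
  by rewrite size_prod_XsubC => -[].
have pf : poly_mul (p n) f = poly_mul (\prod_(z <- s) ('X - z%:P)) (fun k => (p n)`_n * f k).
  apply/funext => k; rewrite {1}ps lc poly_mulZl mulr_sumr.
  by apply: eq_bigr => i _; rewrite mulrCA.
pose rho := (r + 1) / 2.
have rr : 0 < r < rho by rewrite /rho r0/=; lra.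
have rho1 : 0 < rho < 1 by rewrite /rho; lra.
have [B fB] := analytic_cauchy_bound rho1 (proj1 fH2).
have gb : cauchy_bound rho (fun k => (p n)`_n * f k).
  exists (normc (p n)`_n * B) => k.
  by rewrite Normc.normcM -mulrA ler_wpM2l ?normc_ge0.
have := landau_inequality (s := s) rr gb; rewrite -pf => /(_ _ (l2C _ (sq_summable_poly_mul (p n)))).
rewrite Normc.normcM => H.
rewrite ler_pdivlMr// -(@ler_pXn2r _ 2)// ?nnegrE ?sqrtr_ge0//; last first.
  by rewrite !mulr_ge0 ?normc_ge0 ?exprn_ge0//; lra.
rewrite sqr_sqrtr ?(ltW C0)//.
apply: le_trans (_ : C * sqnorm w (poly_mul (p n) f) <= _); last first.
  by rewrite -[leRHS]mulr1 ler_wpM2l ?(ltW C0)// sqnorm_optimal_le1.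
apply: le_trans H; rewrite lerXn2r// ?nnegrE.
- by rewrite !mulr_ge0 ?normc_ge0 ?exprn_ge0//; lra.
- rewrite !mulr_ge0 ?normc_ge0//; apply: prodr_ge0 => z _.
  by rewrite le_max (ltW r0).
rewrite mulrA ler_wpM2r ?normc_ge0// -mulrA [leLHS]mulrC ler_wpM2r ?normc_ge0//.
(* Every zero contributes at least [r], and a zero outside the disk at least [r (1 + eps)] because
   [r < 1]. The bound on [count] is carried along to control the truncated subtraction. *)
have [cs cs'] : (count (fun z => (normc z <= 1 + eps)%R) s <= size s)%N /\
   r ^+ size s * (1 + eps) ^+ (size s - count (fun z => (normc z <= 1 + eps)%R) s) <=
   \prod_(z <- s) Num.max r (normc z).
  elim: (s) => [|z t [IH1 IH2]]; first by rewrite big_nil mulr1.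
  rewrite big_cons/=; have [ze|ze] := lerP (normc z) (1 + eps).
    rewrite add1n subSS ltnS; split=> //; rewrite exprS -mulrA ler_pM//.
    - exact: ltW.
    - by rewrite mulr_ge0 ?exprn_ge0//; lra.
    - by rewrite le_max lexx.
  rewrite add0n subSn//; split; first exact: leqW.
  rewrite exprS [(1 + eps) ^+ _.+1]exprS mulrACA ler_pM//.
  - by rewrite mulr_ge0//; lra.
  - by rewrite mulr_ge0 ?exprn_ge0//; lra.
  rewrite le_max; apply/orP; right; nra.
by rewrite ss in cs'.
Qed.

End Optimal_approximants.

Lemma cvgC_sum (R : realType) (I : Type) (s : seq I) (u : nat -> I -> Cplx R) (l : I -> Cplx R) :
  (forall i, (fun n => u n i) @ \oo --> l i) ->
  (fun n => \sum_(i <- s) u n i) @ \oo --> \sum_(i <- s) l i.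
Proof.
move=> ul; elim: s => [|i s IH].
  by rewrite big_nil; under eq_fun do rewrite big_nil; exact: cvg_cst.
rewrite big_cons; under eq_fun do rewrite big_cons.
by apply: cvgD; [exact: ul|exact: IH].
Qed.

(** * Analytic continuation of the quotient across the unit circle *)

Section Extension.
Variables (R : realType) (w : nat -> R) (f W : nat -> Cplx R) (p : nat -> {poly R[i]}).
Hypothesis w_gt0 : forall n, 0 < w n.
Hypothesis w0 : w 0%N = 1.
Hypothesis w_ratio : (w n / w n.+1) @[n --> \oo] --> (1 : R).
Hypothesis fH2 : H2 w f.
Hypothesis f0 : f 0%N != 0.
Hypothesis fW : is_Wf w f W.
Hypothesis p_opt : forall n, is_optimal_approximant w f n (p n).
Implicit Types (q : {poly R[i]}).

Let f_bound rho : 0 < rho < 1 -> cauchy_bound rho f.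
Proof. by move=> h; exact: analytic_cauchy_bound h (proj1 fH2). Qed.

Let WH2 : H2 w W. Proof. by case: fW => [[]]. Qed.

Let summ_poly q : sq_summable w (poly_mul q f).
Proof. exact: sq_summable_poly_mul. Qed.
Arguments summ_poly q : clear implicits.

(** At least [n / j] zeros lie outside the disk, so the leading coefficient is at most [C / (r b)^n]
    with [b] the [j]-th root of [1 + eps]. *)
Lemma lead_geometric (eps : R) (j N0 : nat) : 0 < eps -> (0 < j)%N ->
  (forall n, (N0 <= n)%N -> (n <= (n - count_zeros (1 + eps) (p n)) * j)%N) ->
  exists2 t : R, 0 < t < 1 & exists2 C : R, 0 < C &
    forall n, (N0 <= n)%N -> normc (p n)`_n <= C * t ^+ n.
Proof.
move=> eps0 j0 H; have e1 : 1 < 1 + eps by lra.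
pose b := expR (ln (1 + eps) / j%:R).
have b1 : 1 < b by rewrite expR_gt1 divr_gt0 ?ltr0n// ln_gt0.
have bj : b ^+ j = 1 + eps.
  rewrite -expRM_natl mulrC divfK ?pnatr_eq0 -?lt0n// lnK// posrE; lra.
(* Close enough to 1 that [r * b = (b + 1) / 2] still exceeds 1. *)
pose r := (1 + b^-1) / 2.
have bi : 0 < b^-1 < 1 by rewrite invr_gt0 invf_lt1; lra.
have r01 : 0 < r < 1 by rewrite /r; lra.
have rb : r * b = (b + 1) / 2 by rewrite /r; field; lra.
have [C C0 pC] := optimal_lead_bound w_gt0 w0 w_ratio fH2 f0 p_opt eps0 r01.
exists (r * b)^-1; first by rewrite invr_gt0 invf_lt1 rb; lra.
exists C => // n /H nj; rewrite exprVn ler_pdivlMr; last by rewrite exprn_gt0// rb; lra.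
apply: le_trans (pC n); rewrite exprMn mulrA ler_wpM2l//.
  by rewrite mulr_ge0 ?normc_ge0 ?exprn_ge0//; lra.
by rewrite -bj -exprM mulnC; apply: ler_weXn2l; [exact: ltW|rewrite bj; exact: nj].
Qed.

(** The squared leading coefficient decays like [t^(2n)] and the shifted [f] has squared norm
    growing at most like [t^(-n)]; the square root of the product decays like [s^n] with [s^2 = t].
    Division by [f] then passes to coefficients. *)
Lemma step_coef_geometric (t C : R) N0 : 0 < t < 1 -> 0 < C ->
  (forall n, (N0 <= n)%N -> normc (p n)`_n <= C * t ^+ n) ->
  exists s r D : R, [/\ 0 < s, s < r, r < 1, 0 < D & forall n k, (N0 <= n)%N ->
    normc (p n.+1 - p n)`_k * r ^+ k <= D * s ^+ n].
Proof.
move=> /andP[t0 t1] C0 pC.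
pose s := Num.sqrt t; have s0 : 0 < s by rewrite sqrtr_gt0.
have s2 : s ^+ 2 = t by rewrite sqr_sqrtr// ltW.
have s1 : s < 1 by rewrite -(@ltr_pXn2r _ 2)// ?nnegrE ?ltW// s2 expr1n.
(* [s < r < r1 < 1] are equally spaced; [r1] serves the bound on the product with [f], and [r] the
   bound after division. *)
pose r := (2 * s + 1) / 3; pose r1 := (s + 2) / 3.
have rr1 : 0 < r < r1 by rewrite /r /r1; lra.
have r101 : 0 < r1 < 1 by rewrite /r1; lra.
have [K K0 HK] := division_bound rr1 (f_bound r101) f0.
have [L L0 HL] := l2_bound_sqnorm w_gt0 w_ratio r101.
have t1' : 0 < t^-1 - 1 by rewrite subr_gt0 invf_gt1.
have [G G0 HG] := weight_growth w_gt0 w_ratio t1'.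
have fs : sq_summable w f := H2_sq_summable w_gt0 fH2.
(* Adding 1 to the squared norm of [f] makes [B] visibly positive. *)
pose B := L * (C ^+ 2 * (G * (sqnorm w f + 1))).
have nf0 : 0 <= sqnorm w f := sqnorm_ge0 w_gt0 fs.
have B0 : 0 < B by rewrite !mulr_gt0 ?exprn_gt0//; lra.
exists s, r, (K * Num.sqrt B); split=> //; first by rewrite /r; lra.
- by rewrite /r; lra.
- by rewrite mulr_gt0// sqrtr_gt0.
move=> n k Nn; rewrite -mulrA; apply: HK => {}k.
have E : L * sqnorm w (poly_mul (p n.+1 - p n) f) <= B * t ^+ n.
  rewrite /B -mulrA ler_wpM2l ?(ltW L0)//.
  apply: le_trans (sqnorm_optimal_step w_gt0 w0 w_ratio fH2 p_opt n) _.
  have [_ XG] := sq_summable_shift w_gt0 (HG n.+1) fs.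
  apply: le_trans (ler_wpM2l (sqr_ge0 _) XG) _.
  have tt : 1 + (t^-1 - 1) = t^-1 by ring.
  rewrite tt.
  apply: le_trans (_ : (C * t ^+ n.+1) ^+ 2 * (G * t^-1 ^+ n.+1 * sqnorm w f) <= _).
    rewrite ler_wpM2r//.
      by rewrite !mulr_ge0 ?exprn_ge0 ?invr_ge0//; exact: ltW.
    by rewrite lerXn2r ?nnegrE ?normc_ge0 ?pC ?(leqW Nn)// mulr_ge0 ?exprn_ge0// ltW.
  have -> : (C * t ^+ n.+1) ^+ 2 * (G * t^-1 ^+ n.+1 * sqnorm w f) =
      C ^+ 2 * (G * sqnorm w f) * t ^+ n.+1.
    have tt' : t ^+ n.+1 * t^-1 ^+ n.+1 = 1.
      by rewrite -exprMn mulfV ?expr1n// gt_eqF.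
    rewrite -[RHS]mulr1 -tt'; set T := t ^+ n.+1; set U := t^-1 ^+ n.+1; ring.
  apply: ler_pM.
  - by rewrite !mulr_ge0 ?sqr_ge0// ltW.
  - by rewrite exprn_ge0// ltW.
  - by rewrite ler_wpM2l ?sqr_ge0// ler_wpM2l ?(ltW G0)// lerDl.
  - by rewrite exprS ger_pMl ?exprn_gt0// ltW.
have := HL _ (summ_poly (p n.+1 - p n)) k.+1; rewrite big_ord_recr/=.
set S := \sum_(i < k) _; have S0 : 0 <= S by rewrite sumr_ge0// => i _; exact: sqr_ge0.
set x := normc _ * r1 ^+ k => Sx.
have x0 : 0 <= x by rewrite mulr_ge0 ?normc_ge0 ?exprn_ge0//; lra.
rewrite -(@ler_pXn2r _ 2)// ?nnegrE ?mulr_ge0 ?sqrtr_ge0 ?exprn_ge0 ?(ltW s0)//.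
rewrite [leRHS]exprMn sqr_sqrtr ?(ltW B0)// -exprM mulnC exprM s2.
by apply: le_trans E; apply: le_trans Sx; rewrite lerDr.
Qed.

(** The [k]-th coefficient is 0 up to [n = k - 1], so its limit is the sum of the increments from
    there on. This is of order [s^(k-1) / r^k], whence the radius [r / s > 1]. *)
Lemma coef_limit (s r D : R) N0 : 0 < s -> s < r -> r < 1 -> 0 < D ->
  (forall n k, (N0 <= n)%N -> normc (p n.+1 - p n)`_k * r ^+ k <= D * s ^+ n) ->
  exists2 c : nat -> Cplx R, cauchy_bound (r / s) c &
    forall k, (fun n => (p n)`_k : Cplx R) @ \oo --> c k.
Proof.
move=> s0 sr r1 D0 H; have r0 : 0 < r by lra.
have s1 : s < 1 by lra.
have ex k : exists2 l : Cplx R, (fun n => (p n)`_k : Cplx R) @ \oo --> l &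
    ((N0 < k)%N -> normc l <= D / (1 - s) / r ^+ k * s ^+ k.-1).
  pose u m : Cplx R := (p (N0 + m).+1 - p (N0 + m))`_k.
  have uD m : normc (u m) <= D * s ^+ N0 / r ^+ k * s ^+ m.
    rewrite mulrAC ler_pdivlMr ?exprn_gt0// -mulrA -exprD.
    exact/H/leq_addr.
  have [l ul lb] := cvg_series_geometric (ltW s0) s1 uD.
  have su m : series u m = (p (N0 + m))`_k - (p N0)`_k.
    elim: m => [|m IH]; first by rewrite /series/= big_geq// addn0 subrr.
    have -> : series u m.+1 = series u m + u m by rewrite seriesSr.
    have -> : u m = (p (N0 + m).+1)`_k - (p (N0 + m))`_k by exact: coefB.
    by rewrite IH addnS addrC addrA subrK.
  exists ((p N0)`_k + l).
    rewrite -(cvg_shiftn N0).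
    suff -> : (fun n => (p (n + N0)%N)`_k : Cplx R) = fun n => (p N0)`_k + series u n.
      by apply: cvgD; [exact: cvg_cst|exact: ul].
    by apply/funext => n; rewrite su addnC addrC subrK.
  move=> Nk; have := lb (k.-1 - N0)%N; rewrite su.
  have kk : (N0 + (k.-1 - N0) = k.-1)%N by rewrite subnKC// -ltnS prednK// (leq_ltn_trans _ Nk).
  rewrite kk.
  (* By the degree bound this coefficient vanishes, so the tail estimate bounds the limit itself. *)
  have -> : (p k.-1)`_k = 0.
    rewrite nth_default//; have [sp _] := p_opt k.-1; move: sp.
    by rewrite prednK// (leq_ltn_trans _ Nk).
  rewrite sub0r opprK addrC => /le_trans; apply.
  rewrite -mulrA -[in leRHS]kk exprD le_eqVlt; apply/orP; left; apply/eqP.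
  by field; rewrite expf_neq0 ?gt_eqF// subr_gt0.
pose c k := projT1 (cid2 (ex k)).
have cP k : (fun n => (p n)`_k : Cplx R) @ \oo --> c k by rewrite /c; case: cid2.
have cN k : (N0 < k)%N -> normc (c k) <= D / (1 - s) / r ^+ k * s ^+ k.-1.
  by rewrite /c; case: cid2.
exists c => //.
pose v k := normc (c k) * (r / s) ^+ k.
have v0 k : 0 <= v k by rewrite mulr_ge0 ?normc_ge0// exprn_ge0// divr_ge0// ltW.
have Ds : 0 <= D / (1 - s) / s by rewrite !divr_ge0//; lra.
exists (D / (1 - s) / s + \sum_(i < N0.+1) v i) => k; rewrite -/(v k).
have [kN|Nk] := ltnP k N0.+1.
  by rewrite (bigD1 (Ordinal kN))//= addrCA lerDl addr_ge0// sumr_ge0.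
apply: le_trans (_ : D / (1 - s) / s <= _); last by rewrite lerDl sumr_ge0.
apply: le_trans (ler_wpM2r _ (cN k Nk)) _; first by rewrite exprn_ge0// divr_ge0// ltW.
case: k Nk => // k _; rewrite le_eqVlt; apply/orP; left; apply/eqP.
rewrite expr_div_n [s ^+ k.+1]exprS/=; field.
by rewrite !expf_neq0 ?gt_eqF//; lra.
Qed.

(** [1 - W] is orthogonal to [W - q f], which lies in the closure. Hence approximating 1 by [q f]
    amounts to approximating [W]. *)
Lemma sqnorm_err_W q : sqnorm w (ps_sub (poly_mul q f) (@ps_one R)) =
  sqnorm w (ps_sub (@ps_one R) W) + sqnorm w (ps_sub W (poly_mul q f)).
Proof.
have [[_ Wcl] Worth] := fW.
have [os _] := sq_summable_one w0.
have Ws := H2_sq_summable w_gt0 WH2.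
have [us _] := sq_summable_sub w_gt0 Ws (summ_poly q).
have [xs _] := sq_summable_sub w_gt0 os Ws.
rewrite -(orthogonal_pythagoras w_gt0 xs us).
  have [es _] := sq_summable_sub w_gt0 (summ_poly q) os.
  apply: (proj2 (eq_sqnorm _ es)) => n.
  rewrite ps_line1 /ps_sub addrA subrK; exact: normc_distC.
apply: Worth; split.
  split; last by rewrite H2norm_sqnorm// ltry.
  apply: analytic_of_cauchy_bound => rho rho01.
  have rho01' : 0 < (rho + 1) / 2 < 1 by lra.
  apply: cauchy_boundB; first by lra.
    exact: analytic_cauchy_bound rho01 (proj1 WH2).
  by apply: poly_mul_bound (f_bound rho01'); lra.
move=> e e0; have [q' q'e] := Wcl e e0; exists (q' - q).
suff -> : ps_sub (poly_mul (q' - q) f) (ps_sub W (poly_mul q f)) = ps_sub (poly_mul q' f) W.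
  exact: q'e.
apply/funext => n; rewrite /ps_sub poly_mulBl opprB addrA subrK.
by [].
Qed.

(** Some [q f] is close to [W], and [p_n f] is at least as close once [n] reaches the size of [q].
    Dividing by the square root of [w k] passes from the norm to the coefficient. *)
Lemma optimal_coef_cvg k : (fun n => poly_mul (p n) f k) @ \oo --> W k.
Proof.
have [[_ Wcl] _] := fW.
have Ws := H2_sq_summable w_gt0 WH2.
apply/cvgC_lt => e e0.
have swk : 0 < Num.sqrt (w k) by rewrite sqrtr_gt0.
have [q] := Wcl (e * Num.sqrt (w k)) (mulr_gt0 e0 swk).
have [qs _] := sq_summable_sub w_gt0 (summ_poly q) Ws.
rewrite H2norm_sqnorm// lte_fin => qe.
exists (size q) => // n /= qn.
have [ds _] := sq_summable_sub w_gt0 Ws (summ_poly (p n)).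
have [_ pmin] := p_opt n.
have [os _] := sq_summable_one w0.
have : sqnorm w (ps_sub (poly_mul (p n) f) (@ps_one R)) <=
       sqnorm w (ps_sub (poly_mul q f) (@ps_one R)).
  rewrite -ler_H2norm//; first by apply: pmin; exact: leqW.
    exact: (proj1 (sq_summable_sub w_gt0 (summ_poly (p n)) os)).
  exact: (proj1 (sq_summable_sub w_gt0 (summ_poly q) os)).
rewrite !sqnorm_err_W lerD2l (sqnormB_sym w_gt0 Ws (summ_poly q)) => h.
have h2 := sqterm_le w_gt0 k ds.
rewrite -(ltr_pM2r swk); apply: le_lt_trans qe.
rewrite -(@ler_pXn2r _ 2) ?nnegrE ?mulr_ge0 ?normc_ge0 ?sqrtr_ge0//.
rewrite exprMn !sqr_sqrtr ?(ltW (w_gt0 _))//; last exact: sqnorm_ge0.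
exact: le_trans h2 h.
Qed.

Lemma quotient_extends (eps : R) (j N0 : nat) : 0 < eps -> (0 < j)%N ->
  (forall n, (N0 <= n)%N -> (n <= (n - count_zeros (1 + eps) (p n)) * j)%N) ->
  ~ quotient_singular_on_circle W f.
Proof.
move=> eps0 j0 H; apply; have [t t01 [C C0 pC]] := lead_geometric eps0 j0 H.
have [s [r [D [s0 sr r1 D0 dD]]]] := step_coef_geometric t01 C0 pC.
have [c cb pc] := coef_limit s0 sr r1 D0 dD.
have rs1 : 1 < r / s by rewrite ltr_pdivlMr// mul1r.
(* A radius strictly between 1 and the radius [r / s] of the bound on [c]. *)
exists ((1 + r / s) / 2); split; first lra.
exists (ps_eval c); split.
  move=> z; rewrite /disk/= => zr; apply: (ps_eval_derivable cb); lra.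
move=> z; rewrite /disk/= => z1 fz.
(* Both sides are limits of the [k]-th coefficient of [p_n f], a finite sum in the coefficients of
   [p n]. *)
have WE : W = cauchy_mul c f.
  apply/funext => k; apply: (cvgC_unique (@optimal_coef_cvg k)).
  apply: cvgC_sum => i; apply: cvgM; [exact: pc|exact: cvg_cst].
have z0 := normc_ge0 z.
have zz : 0 < (normc z + 1) / 2 < 1 by lra.
have zz' : normc z < (normc z + 1) / 2 by lra.
have cb' : cauchy_bound ((normc z + 1) / 2) c by apply: cauchy_boundW cb; lra.
rewrite WE (ps_eval_mul cb' (f_bound zz) zz').
apply/esym; exact: (mulfK fz).
Qed.

End Extension.

(* [closed_field_poly_normal 0] may be any sequence, hence the hypothesis [q != 0]. *)
Lemma count_zeros_le (R : realType) (r : R) (q : {poly R[i]}) n :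
  q != 0 -> (size q <= n.+1)%N -> (count_zeros r q <= n)%N.
Proof.
move=> q0 sq; rewrite /count_zeros; case: closed_field_poly_normal => s /= qs.
rewrite (leq_trans (count_size _ _))// -ltnS (leq_trans _ sq)//.
by rewrite qs size_scale ?lead_coef_eq0// size_prod_XsubC.
Qed.

(** * The upper limit of the proportion of zeros *)

Lemma limn_esup_lt1 (R : realType) (u : nat -> R) :
  (forall n, 0 <= u n) -> (limn_esup (EFin \o u) < 1%:E)%E ->
  exists2 x : R, x < 1 & exists N, forall n, (N <= n)%N -> u n <= x.
Proof.
(* The upper limit is an infimum of suprema over eventual sets of indices; one such supremum is
   already below 1. *)
move=> u0 /ereal_inf_lt[_ [V [N _ NV] <-]] supV.
have uV n : (N <= n)%N -> ((u n)%:E <= ereal_sup ((EFin \o u) @` V))%E.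
  by move=> Nn; apply: ereal_sup_ubound; exists n => //; exact: NV.
case: (ereal_sup _) supV uV => [x|//|] supV uV; last first.
  by have := uV N (leqnn N); rewrite leeNy_eq.
exists x; first by rewrite -lte_fin.
by exists N => n /uV; rewrite lee_fin.
Qed.

Unset Implicit Arguments.
Unset Strict Implicit.

Theorem theorem6p1 (R : realType) (w : nat -> R) (f W : nat -> Cplx R)
    (p : nat -> {poly R[i]})
    (w_gt0 : forall n, 0 < w n) (w0 : w 0%N = 1)
    (w_ratio : (w n / w n.+1) @[n --> \oo] --> (1 : R))
    (w_qi : quasi_integral w)
    (fH2 : H2 w f) (f0 : f 0%N != 0)
    (fW : is_Wf w f W)
    (W_sing : quotient_singular_on_circle W f)
    (p_opt : forall n, is_optimal_approximant w f n (p n))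
    (eps : R) (eps_gt0 : 0 < eps) :
  limn_esup (fun n => ((count_zeros (1 + eps) (p n))%:R / n%:R : R)%:E) = 1%:E.
Proof.
pose u n : R := (count_zeros (1 + eps) (p n))%:R / n%:R.
have cn n : (count_zeros (1 + eps) (p n) <= n)%N.
  apply: count_zeros_le; last by case: (p_opt n).
  exact: (optimal_neq0 w_gt0 w0 w_ratio fH2 f0 p_opt).
have u0 n : 0 <= u n by rewrite divr_ge0.
have u1 n : u n <= 1.
  (* At [n = 0] the quotient takes the default value 0. *)
  rewrite /u; case: n => [|n]; first by rewrite invr0 mulr0.
  by rewrite ler_pdivrMr ?ltr0n// mul1r ler_nat.
apply/eqP; rewrite eq_le; apply/andP; split.
  apply: ge_ereal_inf; exists (ereal_sup ((fun n => (u n)%:E) @` setT)).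
    by exists setT => //; exact: filterT.
  by apply: ge_ereal_sup => _ [n _ <-]; rewrite lee_fin.
rewrite leNgt; apply/negP => /(limn_esup_lt1 u0)[x x1 [N uN]].
(* If at most [x n] zeros lie in the disk, at least [(1 - x) n] lie outside; this is at least
   [n / j] as soon as [j >= 1 / (1 - x)]. *)
pose j := (Num.truncn (1 - x)^-1).+1.
have jx : (1 - x)^-1 < j%:R by rewrite truncnS_gt.
apply: (@quotient_extends R w f W p w_gt0 w0 w_ratio fH2 f0 fW p_opt eps j N eps_gt0 _ _ W_sing) => //.
move=> n Nn; have := uN n Nn; rewrite /u.
case: n Nn => [//|n] Nn; rewrite ler_pdivrMr ?ltr0n// => h.
rewrite -(ler_nat R) natrM natrB//.
have j0 : 0 < j%:R :> R by rewrite ltr0n.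
have x1' : 0 < 1 - x by rewrite subr_gt0.
have jx' : 1 <= (1 - x) * j%:R by rewrite mulrC -ler_pdivrMr// div1r ltW.
apply: (@le_trans _ _ (((1 - x) * n.+1%:R) * j%:R)).
  by rewrite mulrAC ler_peMl.
by rewrite ler_wpM2r ?(ltW j0)//; lra.
Qed.
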